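(* Let $\boldsymbol\alpha$ be an arbitrary sequence in $\mathbb D$, $\mu$ a measure on $\mathbb T$, $(\phi_n)_{n\ge0}$ the corresponding ORF, $\mathcal A=\mathcal A(\boldsymbol\alpha)$ and $\mathcal H=\mathcal H(\boldsymbol a)$ with $\boldsymbol a=\mathcal S_{\boldsymbol\alpha}(\mu)$. Let $n\ge1$, $v\in\mathbb T$, let $Q_n^v=\phi_n+v\phi_n^*$ be the $n$-th para-orthogonal rational function related to $v$, and let $\mu_n^v$ be the associated measure. Then: 1. The matrix of $T_{\mu_n^v}$ with respect to $(\phi_k)_{k=0}^{n-1}$ is $$\mathcal V^{(n;u)}=\tilde\zeta_{\mathcal A_n}(\mathcal H_n^u),\qquad u=\tilde\zeta_{a_n}(v)=\frac{v+a_n}{1+\overline{a_n}v}.$$ 2. The zeros of $Q_n^v$ are the eigenvalues of $\mathcal V^{(n;u)}$. If $\lambda$ is a zero of $Q_n^v$, the related eigenvectors of $\mathcal V^{(n;u)}$ are spanned by $\begin{pmatrix}\phi_0(\lambda)&\cdots&\phi_{n-1}(\lambda)\end{pmatrix}^\dag$. 3. $Q_n^v=\dfrac{q_n^v}{\pi_n}$ with $q_n^v$ proportional to the characteristic polynomial of $\mathcal V^{(n;u)}$.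
   Context: $\mathbb T$ is the unit circle, $\mathbb D$ the open unit disk. A measure $\mu$ on $\mathbb T$ (as in the hypothesis) is a probability Borel measure on $\mathbb T$ with infinite support. $L^2_\mu$ carries the inner product $\langle f,g\rangle_\mu=\int\overline{f}\,g\,d\mu$. For any probability Borel measure $\nu$ on $\mathbb T$ (possibly finitely supported), $T_\nu$ is the operator $f(z)\mapsto zf(z)$ on $L^2_\nu$. ORF. Let $\boldsymbol\alpha=(\alpha_n)_{n\ge1}$ be a sequence in $\mathbb D$ and set $\alpha_0=0$. For $n\ge0$ let $\varpi_n(z)=1-\overline{\alpha_n}z$, $\varpi_n^*(z)=z-\alpha_n$, $\zeta_n=\varpi_n^*/\varpi_n$; $\pi_n=\varpi_1\cdots\varpi_n$. Let $B_0=1$, $B_n=\zeta_1\cdots\zeta_n$, and $f_*(z)=\overline{f(1/\overline z)}$. The orthogonal rational functions (ORF) $(\phi_n)_{n\ge0}$ of $\mu$ associated with $\boldsymbol\alpha$ are the result of orthonormalizing $(B_n)_{n\ge0}$ in $L^2_\mu$ (so $\phi_0,\dots,\phi_n$ is an orthonormal basis of $\operatorname{span}\{B_0,\dots,B_n\}$ for every $n$), with unimodular factors chosen so that $\phi_0=1$ and, with $\phi_n^*=B_n\phi_{n*}$, $$\begin{pmatrix}\phi_n\\ \phi_n^*\end{pmatrix}=e_n\frac{\varpi_{n-1}}{\varpi_n}\begin{pmatrix}1&a_n\\ \overline{a_n}&1\end{pmatrix}\begin{pmatrix}\zeta_{n-1}\phi_{n-1}\\ \phi_{n-1}^*\end{pmatrix},\quad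 e_n=\sqrt{\frac{\varpi_n(\alpha_n)}{\varpi_{n-1}(\alpha_{n-1})}\frac1{1-|a_n|^2}},\quad n\ge1,$$ for some $a_n\in\mathbb D$. This normalization exists and both $(\phi_n)$ and $\boldsymbol a=(a_n)_{n\ge1}$ are then uniquely determined; one writes $\boldsymbol a=\mathcal S_{\boldsymbol\alpha}(\mu)$. The function $Q_n^v$ has $n$ different zeros, all lying on $\mathbb T$. The measure $\mu_n^v$ associated with $Q_n^v$ is the measure supported on these zeros with mass $\big(\sum_{k=0}^{n-1}|\phi_k(\lambda)|^2\big)^{-1}$ at each zero $\lambda$; $(\phi_k)_{k=0}^{n-1}$ is an orthonormal basis of the $n$-dimensional space $L^2_{\mu_n^v}$ (exactness of the rational Szegő quadrature formula). Matrices. The matrix of an operator $T$ with respect to an orthonormal basis $(f_k)$ has entries $\langle f_i,Tf_j\rangle$. $\mathcal A(\boldsymbol\alpha)=\operatorname{diag}(\alpha_0,\alpha_1,\alpha_2,\dots)$. With $\rho_n=\sqrt{1-|a_n|^2}$ and the convention $a_0=1$, $\mathcal H(\boldsymbol a)=(h_{k,j})_{k,j\ge0}$ is the Hessenberg matrix with $h_{k,j}=-a_{j+1}\rho_j\rho_{j-1}\cdots\rho_{k+1}\overline{a_k}$ for $k\le j$ (for $k=j$ the product of $\rho$'s is empty), $h_{j+1,j}=\rho_{j+1}$, and $h_{k,j}=0$ for $k>j+1$. A subscript ${}_n$ on a matrix denotes its principal submatrix of order $n$ (first $n$ rows and columns). $\mathcal H_n$ depends only on $a_1,\dots,a_n$;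 $\mathcal H_n^u$ is the (unitary) matrix obtained from $\mathcal H_n$ by replacing $a_n$ by $u\in\mathbb T$ (this affects only the last column). Operator Möbius transformation. For operators (matrices) $A,T$ with $\|A\|<1$, $\|T\|\le1$, set $\eta_A=\sqrt{1-AA^\dag}$ and $\tilde\zeta_A(T)=\eta_A^{-1}(T+A)(1+A^\dag T)^{-1}\eta_{A^\dag}$. The superscript $\dag$ denotes conjugate transpose. *)

(* Defs.v *)
(* MathComp + MathComp-Analysis; the complex numbers are R[i] for R : realType. *)
From HB Require Import structures.
From mathcomp Require Import all_boot all_order all_algebra.
From mathcomp Require Import complex.
From mathcomp Require Import all_classical all_reals all_analysis.
Set Implicit Arguments.
Unset Strict Implicit.
Unset Printing Implicit Defensive.
Import Order.TTheory GRing.Theory Num.Theory.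
Import numFieldNormedType.Exports.
Local Open Scope complex_scope.
Local Open Scope classical_set_scope.
Local Open Scope sesquilinear_scope.
Local Open Scope ring_scope.

(* C with the Borel sigma-algebra of the topology of the modulus. *)
Definition borelC (R : realType) := g_sigma_algebraType (@open (R[i])^o).

Definition normC (R : realType) (z : R[i]) : R := complex.Re `|z|.

Section Circle.
Variable R : realType.
Implicit Types (nu : {measure set (borelC R) -> \bar R}) (f g : R[i] -> R[i]).

Definition circle : set (borelC R) := [set z : R[i] | `|z| = 1].

(* Borel probability measures on the circle are encoded as Borel probability
   measures on C for which the complement of the circle is null. *)
Definition circle_probability nu :=
  nu setT = 1%E /\ nu (~` circle) = 0%E.

Definition msupport nu : set R[i] :=
  [set z | forall U : set (R[i])^o, open U -> U z -> (0 < nu U)%E].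

Definition cintegral nu f : R[i] :=
  (\int[nu]_(z in circle) complex.Re (f z))
  +i* (\int[nu]_(z in circle) complex.Im (f z)).

Definition inner nu f g : R[i] := cintegral nu (fun z => (f z)^* * g z).

Definition square_integrable nu f :=
  [/\ measurable_fun circle (fun z : borelC R => complex.Re (f z)),
      measurable_fun circle (fun z : borelC R => complex.Im (f z)) &
      (\int[nu]_(z in circle) ((normC (f z)) ^+ 2)%:E < +oo)%E].

Definition orthonormal_basis nu (n : nat) (f : 'I_n -> R[i] -> R[i]) :=
  [/\ forall i, square_integrable nu (f i),
      forall i j, inner nu (f i) (f j) = (i == j)%:R &
      forall g, square_integrable nu g -> exists c : 'I_n -> R[i],
        {ae nu, forall z : borelC R, circle z -> g z = \sum_i c i * f i z}].

(* M is the matrix, in the orthonormal basis f of L^2(nu), of the operator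
   g(z) |-> z g(z). *)
Definition matrix_of_mult nu (n : nat) (f : 'I_n -> R[i] -> R[i])
    (M : 'M[R[i]]_n) :=
  [/\ circle_probability nu, orthonormal_basis nu f &
      forall i j, M i j = inner nu (f i) (fun z => z * f j z)].

End Circle.

Section RationalFunctions.
Variable R : realType.

Definition ratfun := {fraction {poly R[i]}}.
Implicit Types (f : ratfun) (z c : R[i]).

Definition ratC c : ratfun := FracField.tofrac c%:P.

(* Numerator and denominator of f in lowest terms, each up to a nonzero
   constant factor (the same for both). *)
Definition rnum f : {poly R[i]} :=
  (repr f).1 %/ gcdp (repr f).1 (repr f).2.
Definition rden f : {poly R[i]} :=
  (repr f).2 %/ gcdp (repr f).1 (repr f).2.

(* Value of f at z; it is 0 (by convention) at the poles of f. *)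
Definition reval f z : R[i] := (rnum f).[z] / (rden f).[z].

(* A pole is never a zero, despite the convention in reval. *)
Definition is_zero f z := root (rnum f) z.

(* f_*(z) = conj (f (1 / conj z)) *)
Definition lower_star f : ratfun :=
  let subst (p : {poly R[i]}) :=
    (map_poly (fun c => ratC c^*) p).[(FracField.tofrac 'X)^-1] in
  subst (rnum f) / subst (rden f).

Definition in_span (n : nat) (g : nat -> ratfun) f :=
  exists c : 'I_n -> R[i], f = \sum_(i < n) ratC (c i) * g i.

End RationalFunctions.

Section ORF.
Variable R : realType.
Implicit Types (alpha a : nat -> R[i]) (phi : nat -> ratfun R).

Definition varpi alpha n : {poly R[i]} := 1 - (alpha n)^* *: 'X.
Definition varpi_star alpha n : {poly R[i]} := 'X - (alpha n)%:P.
Definition zeta alpha n : ratfun R :=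
  FracField.tofrac (varpi_star alpha n) / FracField.tofrac (varpi alpha n).
Definition pi_poly alpha n : {poly R[i]} :=
  \prod_(1 <= k < n.+1) varpi alpha k.
Definition blaschke alpha n : ratfun R := \prod_(1 <= k < n.+1) zeta alpha k.

Definition upper_star alpha n (f : ratfun R) : ratfun R :=
  blaschke alpha n * lower_star f.

Definition disk_sequence (s : nat -> R[i]) :=
  forall n, (1 <= n)%N -> `|s n| < 1.

Definition e_coef alpha a n : R[i] :=
  sqrtC ((varpi alpha n).[alpha n] / (varpi alpha n.-1).[alpha n.-1]
         * (1 / (1 - `|a n| ^+ 2))).

(* phi is the sequence of ORF of mu associated with alpha, and a (from the
   index 1 on) is the sequence S_alpha(mu). *)
Record is_ORF (mu : {measure set (borelC R) -> \bar R}) alpha phi a : Prop := {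
  orf_span : forall n f,
    in_span n.+1 phi f <-> in_span n.+1 (blaschke alpha) f;
  orf_orthonormal : forall i j,
    inner mu (reval (phi i)) (reval (phi j)) = (i == j)%:R;
  orf0 : phi 0%N = 1;
  orf_disk : disk_sequence a;
  orf_rec : forall n, (1 <= n)%N ->
    let ratio : ratfun R := FracField.tofrac (varpi alpha n.-1)
                            / FracField.tofrac (varpi alpha n) in
    let x := zeta alpha n.-1 * phi n.-1 in
    let y := upper_star alpha n.-1 (phi n.-1) in
    phi n = ratC (e_coef alpha a n) * ratio * (x + ratC (a n) * y) /\
    upper_star alpha n (phi n) =
      ratC (e_coef alpha a n) * ratio * (ratC (a n)^* * x + y)
}.

Definition para_orf alpha phi n (v : R[i]) : ratfun R :=
  phi n + ratC v * upper_star alpha n (phi n).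

Definition para_weight phi n (z : R[i]) : R :=
  (\sum_(k < n) normC (reval (phi k) z) ^+ 2)^-1.

Lemma para_weight_ge0 phi n z : 0 <= para_weight phi n z.
Proof. by rewrite invr_ge0 sumr_ge0// => k _; rewrite sqr_ge0. Qed.

Definition para_zeros alpha phi n v : seq R[i] :=
  finmap.enum_fset (fset_set [set z | is_zero (para_orf alpha phi n v) z]).

(* mu_n^v, as a finite weighted sum of Dirac masses at the zeros *)
Definition para_measure alpha phi n v :
    {measure set (borelC R) -> \bar R} :=
  let zs := para_zeros alpha phi n v in
  msum (fun k : nat =>
      mscale (NngNum (para_weight_ge0 phi n zs`_k))
             (dirac (zs`_k : borelC R)))
    (size zs).

End ORF.

Section Matrices.
Variable R : realType.
Implicit Types (alpha a : nat -> R[i]).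

Definition principal (M : nat -> nat -> R[i]) (n : nat) : 'M[R[i]]_n :=
  \matrix_(i < n, j < n) M i j.

Definition diag_seq alpha (k j : nat) : R[i] := if k == j then alpha k else 0.

Definition rho a (n : nat) : R[i] := sqrtC (1 - `|a n| ^+ 2).

Definition hessenberg a (k j : nat) : R[i] :=
  if (k <= j)%N then
    - a j.+1 * (\prod_(k.+1 <= i < j.+1) rho a i) * (a k)^*
  else if k == j.+1 then rho a k else 0.

Definition set_entry a (n : nat) (u : R[i]) (k : nat) : R[i] :=
  if k == n then u else a k.

(* Nonnegative square root of a positive semidefinite matrix, through the
   unitary diagonalization M = P^-1 *m diag_mx d *m P. *)
Definition sqrtmx (n : nat) (M : 'M[R[i]]_n) : 'M[R[i]]_n :=
  invmx (spectralmx M) *m diag_mx (map_mx sqrtC (spectral_diag M))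
    *m spectralmx M.

Definition eta (n : nat) (A : 'M[R[i]]_n) : 'M[R[i]]_n :=
  sqrtmx (1%:M - A *m A^t*).

Definition mobius_mx (n : nat) (A T : 'M[R[i]]_n) : 'M[R[i]]_n :=
  invmx (eta A) *m (T + A) *m invmx (1%:M + A^t* *m T) *m eta (A^t*).

Definition mobius (w z : R[i]) : R[i] := (z + w) / (1 + w^* * z).

End Matrices.

(* Main.v *)
Require Import Defs.
From mathcomp Require Import all_boot all_order all_algebra.
From mathcomp Require Import complex.
From mathcomp Require Import all_classical all_reals all_analysis.
From mathcomp Require Import measurable_realfun.
From mathcomp Require Import ring lra.
Import Order.TTheory GRing.Theory Num.Theory.
Local Open Scope complex_scope.
Local Open Scope classical_set_scope.
Local Open Scope sesquilinear_scope.
Local Open Scope ring_scope.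
Set Implicit Arguments.
Unset Strict Implicit.
Unset Printing Implicit Defensive.

(* Only the recurrence for (phi_k, phi_k^* ) matters.  With
   f_k = varpi_k phi_k / sqrt (1 - |alpha_k|^2), it says that the row (f_k)
   satisfies zeta_j f_j = sum_k f_k h_(k,j), up to a multiple of Q_n^v in the
   last column once a_n is replaced by u; undoing the operator Moebius
   transformation, the row p(l) = (phi_0(l), .., phi_(n-1)(l)) is a left
   eigenvector of the unitary matrix V exactly when l is a zero of Q_n^v.
   Since the Hessenberg matrix has nonzero subdiagonal, all left eigenvectors
   are multiples of such rows, so that V has simple spectrum d_1, .., d_n on
   the circle, and the numerator of Q_n^v, of degree at most n with the n zeros
   d_i, is a multiple of the characteristic polynomial.  The unitary matrix
   diagonalizing V has rows proportional to the p(d_i); reading its rows and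
   columns as orthonormal systems gives the quadrature formula and the matrix
   of multiplication by z. *)

(** * Hessenberg matrices and operator Moebius transformations *)

Section Adjoint.
Variable R : realType.

Lemma adjmxM m n p (M : 'M[R[i]]_(m, n)) (N : 'M[R[i]]_(n, p)) :
  (M *m N)^t* = N^t* *m M^t*.
Proof. by rewrite trmx_mul map_mxM. Qed.

Lemma adjmxZ m n c (X : 'M[R[i]]_(m, n)) : (c *: X)^t* = c^* *: X^t*.
Proof. by rewrite linearZ /= map_mxZ. Qed.

Lemma adjmx_diag n (d : 'rV[R[i]]_n) : (diag_mx d)^t* = diag_mx (map_mx Num.conj d).
Proof. by rewrite tr_diag_mx map_diag_mx. Qed.

Lemma adjmx_mul_unitary n (V : 'M[R[i]]_n) : V \is unitarymx -> V^t* *m V = 1%:M.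
Proof. by rewrite -trmxC_unitary => /unitarymxP; rewrite trmxCK. Qed.

(** The adjoint of [y *m V = l *: y] has eigenvalue [l^*] for [V^t*]; applying [V] and [l * l^* = 1]
    turns it into the eigenvalue [l] for [V]. The recurrence yields row eigenvectors, whereas the
    theorem asks for columns. *)
Lemma unitary_left_right_eigen n (V : 'M[R[i]]_n) (y : 'rV[R[i]]_n) l :
  V \is unitarymx -> `|l| = 1 -> y *m V = l *: y <-> V *m y^t* = l *: y^t*.
Proof.
move=> V_unitary l1; have ll : l * l^* = 1 by rewrite -normCK l1 expr1n.
split=> /(congr1 (fun X => X^t*)); rewrite adjmxM adjmxZ ?trmxCK => eq_y.
  rewrite -[y^t* in RHS]mul1mx -(unitarymxP V_unitary) -mulmxA eq_y.
  by rewrite -scalemxAr scalerA ll scale1r.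
rewrite -[y in RHS]mulmx1 -(adjmx_mul_unitary V_unitary) mulmxA eq_y.
by rewrite -scalemxAl scalerA ll scale1r.
Qed.

Lemma principal_diag_seq n (alpha : nat -> R[i]) :
  principal (diag_seq alpha) n = diag_mx (\row_(k < n) alpha k).
Proof.
apply/matrixP => i j; rewrite !mxE /diag_seq -val_eqE.
by case: eqP => _; rewrite ?mulr1n ?mulr0n.
Qed.

End Adjoint.

(** * Unitarity of the truncated Hessenberg matrix with unimodular last parameter *)

Section Hessenberg.
Variable R : realType.
Implicit Types (a : nat -> R[i]) (f g h : nat -> R[i]).

Definition dot n f g : R[i] := \sum_(k < n) (f k)^* * g k.
Definition delta (i k : nat) : R[i] := (k == i)%:R.

Lemma dot_linear n f g h x y :
  dot n f (fun k => x * g k + y * h k) = x * dot n f g + y * dot n f h.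
Proof.
rewrite /dot !mulr_sumr -big_split /=; apply: eq_bigr => k _; ring.
Qed.

Lemma dotC n f g : dot n f g = (dot n g f)^*.
Proof.
by rewrite /dot rmorph_sum; apply: eq_bigr => k _ /=; rewrite rmorphM /= conjCK mulrC.
Qed.

Lemma dot_deltar n f i : (i < n)%N -> dot n f (delta i) = (f i)^*.
Proof.
move=> lt_in; rewrite /dot (bigD1 (Ordinal lt_in)) //= /delta eqxx mulr1.
rewrite big1 ?addr0 // => k; rewrite -val_eqE /= => /negbTE ->; exact: mulr0.
Qed.

Lemma eq_dot n f f' g g' : f =1 f' -> g =1 g' -> dot n f g = dot n f' g'.
Proof. by move=> ef eg; apply: eq_bigr => k _; rewrite ef eg. Qed.
Arguments eq_dot {n f f' g g'}.

(* The coefficients of phi_j^* (suitably rescaled) in the rescaled ORF. *)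
Definition star_coef a (j k : nat) : R[i] :=
  if (k <= j)%N then (\prod_(k.+1 <= i < j.+1) rho a i) * (a k)^* else 0.

Lemma star_coef0 a k : a 0%N = 1 -> star_coef a 0 k = delta 0 k.
Proof.
move=> a0; rewrite /star_coef /delta leqn0; case: eqP => // ->.
by rewrite big_geq // a0 rmorph1 mulr1.
Qed.

(** The rescaled form of phi_(j+1)^* as a combination of phi_(j+1) and phi_j^*, the same recursion
    as [ysS] below. *)
Lemma star_coefS a j k :
  star_coef a j.+1 k = (a j.+1)^* * delta j.+1 k + rho a j.+1 * star_coef a j k.
Proof.
rewrite /star_coef /delta; case: (ltngtP k j.+1) => [lt_kj|lt_jk|->].
- rewrite -ltnS lt_kj mulr0 add0r big_nat_recr /=; last exact: lt_kj.
  by rewrite mulrA [_ * rho _ _]mulrC.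
- by rewrite leqNgt (ltn_trans (ltnSn j) lt_jk) !mulr0 addr0.
- by rewrite ltnn mulr0 addr0 mulr1 big_geq // mul1r.
Qed.

Lemma star_coef_gt a j k : (j < k)%N -> star_coef a j k = 0.
Proof. by move=> lt_jk; rewrite /star_coef leqNgt lt_jk. Qed.

(** Column j is a multiple of the coefficient vector of phi_j^* plus a multiple of a unit vector, so
    inner products of columns reduce to those of [star_coef] and [delta]. *)
Lemma hessenbergE a k j :
  hessenberg a k j = - a j.+1 * star_coef a j k + rho a j.+1 * delta j.+1 k.
Proof.
rewrite /hessenberg /star_coef /delta; case: leqP => [le_kj|lt_jk].
  by rewrite ltn_eqF ?ltnS // mulr0 addr0 mulrA.
by case: eqP => [->|_]; rewrite !mulr0 add0r ?mulr1.
Qed.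

Lemma hessenberg_gt a k j : (j.+1 < k)%N -> hessenberg a k j = 0.
Proof.
move=> lt_jk; rewrite /hessenberg leqNgt (ltn_trans (ltnSn j) lt_jk) /=.
by rewrite gtn_eqF.
Qed.

Lemma hessenberg_subdiag a j : hessenberg a j.+1 j = rho a j.+1.
Proof. by rewrite /hessenberg ltnn eqxx. Qed.

Lemma sqr_rho a k : rho a k ^+ 2 = 1 - `|a k| ^+ 2.
Proof. by rewrite /rho sqrtCK. Qed.

Lemma conj_sqrtC (x : R[i]) : 0 <= x -> (sqrtC x)^* = sqrtC x.
Proof. by move=> x_ge0; rewrite conj_Creal // ger0_real // sqrtC_ge0. Qed.

Lemma subr_sqr_norm_ge0 (x : R[i]) : `|x| <= 1 -> 0 <= 1 - `|x| ^+ 2.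
Proof. by move=> x1; rewrite subr_ge0 expr_le1. Qed.

Lemma subr_sqr_norm_gt0 (x : R[i]) : `|x| < 1 -> 0 < 1 - `|x| ^+ 2.
Proof. by move=> x1; rewrite subr_gt0 expr_lt1. Qed.

Lemma conj_rho a k : `|a k| <= 1 -> (rho a k)^* = rho a k.
Proof. by move=> ak; apply: conj_sqrtC; exact: subr_sqr_norm_ge0. Qed.

Lemma rho_gt0 a k : `|a k| < 1 -> 0 < rho a k.
Proof. by move=> ak; rewrite sqrtC_gt0 subr_sqr_norm_gt0. Qed.

Section Unitary.
Variables (a : nat -> R[i]) (n : nat).
Hypotheses (a0 : a 0%N = 1) (a_le1 : forall k, (k <= n)%N -> `|a k| <= 1).

(** By [star_coefS] the squared norm at j + 1 is |a_(j+1)|^2 + rho_(j+1)^2 = 1: the cross terms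
    vanish because [star_coef a j] has no entry at index j + 1. *)
Lemma star_coef_unit j : (j < n)%N -> dot n (star_coef a j) (star_coef a j) = 1.
Proof.
elim: j => [|j IHj] lt_jn.
  rewrite (eq_dot (fun k => star_coef0 k a0) (fun k => star_coef0 k a0)).
  by rewrite dot_deltar // /delta eqxx rmorph1.
rewrite (eq_dot (frefl _) (star_coefS a j)) // dot_linear dot_deltar //.
rewrite dotC (eq_dot (frefl _) (star_coefS a j)) // dot_linear dot_deltar //.
rewrite IHj 1?ltnW // !(star_coef_gt _ (ltnSn j)) star_coefS /delta eqxx.
rewrite star_coef_gt // rmorph0 !mulr0 add0r addr0 !mulr1 conjCK.
rewrite conj_rho ?a_le1 1?ltnW // -expr2 sqr_rho -normCKC; ring.
Qed.

(** Induction on j. At j = i + 1 two opposite terms rho_j conj(a_j) cancel; beyond that, column i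
    has no entry at the new index and only the previous case remains. *)
Lemma hessenberg_orth_star i j : (i < j < n)%N ->
  dot n (hessenberg a ^~ i) (star_coef a j) = 0.
Proof.
elim: j => [|j IHj] /andP[lt_ij lt_jn] //.
rewrite (eq_dot (frefl _) (star_coefS a j)) // dot_linear dot_deltar //.
move: lt_ij; rewrite ltnS leq_eqVlt => /orP[/eqP eq_ij|lt_ij]; last first.
  by rewrite hessenberg_gt // rmorph0 mulr0 add0r IHj ?mulr0 // lt_ij ltnW.
rewrite {i}eq_ij in IHj *.
rewrite hessenberg_subdiag dotC (eq_dot (frefl _) (hessenbergE a ^~ j)) //.
rewrite dot_linear star_coef_unit 1?ltnW // dot_deltar // star_coef_gt //.
by rewrite rmorph0 mulr0 addr0 mulr1 rmorphN conj_rho ?a_le1 1?ltnW // mulrN mulrC subrr.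
Qed.

Lemma hessenberg_orth i j : (i < j < n)%N ->
  dot n (hessenberg a ^~ i) (hessenberg a ^~ j) = 0.
Proof.
move=> ltij; rewrite (eq_dot (frefl _) (hessenbergE a ^~ j)) // dot_linear.
rewrite hessenberg_orth_star // mulr0 add0r /dot big1 ?mulr0 // => k _.
rewrite /delta; case: eqP => [->|]; last by rewrite mulr0.
by rewrite hessenberg_gt ?rmorph0 ?mul0r // ltnS; case/andP: ltij.
Qed.

Lemma hessenberg_unit j : `|a n| = 1 -> (j < n)%N ->
  dot n (hessenberg a ^~ j) (hessenberg a ^~ j) = 1.
Proof.
move=> an lt_jn; rewrite (eq_dot (frefl _) (hessenbergE a ^~ j)) // dot_linear.
rewrite [in X in X + _]dotC (eq_dot (frefl _) (hessenbergE a ^~ j)) // dot_linear.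
rewrite star_coef_unit //.
move: (lt_jn); rewrite leq_eqVlt => /orP[/eqP eq_jn|lt_jn1].
  (* In the last column the unit vector sits at index n, outside the truncation; its coefficient
     rho_n vanishes because |a_n| = 1. *)
  have rho0 : rho a j.+1 = 0 by rewrite /rho eq_jn an expr1n subrr sqrtC0.
  by rewrite rho0 !mul0r !addr0 mulr1 rmorphN mulrNN -normCK eq_jn an expr1n.
rewrite !dot_deltar // hessenberg_subdiag star_coef_gt // rmorph0 mulr0 addr0.
rewrite conj_rho ?a_le1 1?ltnW // mulr1 rmorphN mulrNN -normCK -expr2 sqr_rho; ring.
Qed.

Lemma hessenberg_unitary : `|a n| = 1 ->
  principal (hessenberg a) n \is unitarymx.
Proof.
move=> an; rewrite -trmxC_unitary; apply/unitarymxP/matrixP => i j.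
rewrite trmxCK !mxE.
transitivity (dot n (hessenberg a ^~ i) (hessenberg a ^~ j)).
  by apply: eq_bigr => k _; rewrite !mxE.
case: (ltngtP i j) => [lt_ij|lt_ji|/val_inj ->].
- by rewrite hessenberg_orth ?lt_ij //= -val_eqE ltn_eqF.
- by rewrite dotC hessenberg_orth ?lt_ji //= -val_eqE gtn_eqF ?rmorph0.
- by rewrite hessenberg_unit // eqxx.
Qed.

End Unitary.
End Hessenberg.

(** * The operator Moebius transformation with a diagonal parameter *)

Section DiagonalMobius.
Variable R : realType.

(** In the application [W] is the inverse of 1 - A A^†. After expansion the cross terms agree by
    commutation, and the square terms by H^† W H = 1 + H^† A W A^† H and A^† W A = W - 1. *)
Lemma mobius_adj_identity n (A H W : 'M[R[i]]_n) :
    H^t* *m H = 1%:M -> W - A *m W *m A^t* = 1%:M ->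
    W - A^t* *m W *m A = 1%:M -> W *m A = A *m W -> A^t* *m W = W *m A^t* ->
  (H + A)^t* *m W *m (H + A) = (1%:M + A^t* *m H)^t* *m W *m (1%:M + A^t* *m H).
Proof.
move=> HH WA1 AW1 WA AdW.
rewrite !linearD /= !map_mxD /= trmx1 map_mx1 adjmxM trmxCK.
rewrite !(mulmxDl, mulmxDr, mul1mx, mulmx1) !mulmxA.
have -> : H^t* *m W *m H = 1%:M + H^t* *m A *m W *m A^t* *m H.
  have {1}-> : W = 1%:M + A *m W *m A^t* by rewrite -WA1 subrK.
  by rewrite mulmxDr mulmx1 mulmxDl HH !mulmxA.
have -> : A^t* *m W *m A = W - 1%:M by rewrite -AW1 subKr.
rewrite -(mulmxA _ W A) WA mulmxA AdW.
move: (1%:M) (H^t* *m A *m W) (_ *m H) (W *m _ *m _) => I X Y Z.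
by apply/matrixP => i j; rewrite !mxE; ring.
Qed.

(** The assumed identity, multiplied by the inverses of K^† and K on its two sides, leaves [W], and
    E W E = E D D E = 1. *)
Lemma mobius_adj_mul n (A H D E K : 'M[R[i]]_n) (W := D *m D) :
    D^t* = D -> E^t* = E -> D *m E = 1%:M -> K \in unitmx ->
    (H + A)^t* *m W *m (H + A) = K^t* *m W *m K ->
  (D *m (H + A) *m invmx K *m E)^t* *m (D *m (H + A) *m invmx K *m E) = 1%:M.
Proof.
move=> D_adj E_adj DE K_unit LWL; have ED := mulmx1C DE.
transitivity (E *m (invmx K)^t* *m ((H + A)^t* *m W *m (H + A)) *m invmx K *m E).
  by rewrite !adjmxM D_adj E_adj /W !mulmxA.
have KK : (invmx K)^t* *m K^t* = 1%:M.
  by rewrite -adjmxM mulmxV // trmx1 map_mx1.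
rewrite LWL !mulmxA -(mulmxA E) KK mulmx1 -(mulmxA _ K).
by rewrite mulmxV // mulmx1 ED mul1mx DE.
Qed.

Lemma invmx_mulmx1 n (D E : 'M[R[i]]_n) : D *m E = 1%:M -> invmx E = D.
Proof.
move=> DE; have [_ E_unit] := mulmx1_unit DE.
by rewrite -[LHS]mul1mx -DE -mulmxA mulmxV ?mulmx1.
Qed.

(* P *m diag_mx x = diag_mx d *m P forces d i = x j wherever P i j != 0. *)
Lemma sqrtmx_diag n (x : 'rV[R[i]]_n) :
  sqrtmx (diag_mx x) = diag_mx (map_mx sqrtC x).
Proof.
have normal_x : diag_mx x \is normalmx.
  by apply/normalmxP; rewrite adjmx_diag !mulmx_diag; congr diag_mx;
    apply/rowP => i; rewrite !mxE mulrC.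
rewrite /sqrtmx; set P := spectralmx _; set d := spectral_diag _.
have P_unit : P \in unitmx by exact: spectral_unit.
have Pd : P *m diag_mx x = diag_mx d *m P.
  by rewrite (orthomx_spectralP normal_x) -mulmxA mulKVmx.
rewrite -mulmxA; apply: canLR (mulKmx P_unit) _.
apply/matrixP => i j; rewrite mul_diag_mx mul_mx_diag !mxE.
have /matrixP/(_ i j) := Pd; rewrite mul_diag_mx mul_mx_diag !mxE.
have [->|Pij0] := eqVneq (P i j) 0; first by rewrite !mul0r !mulr0.
by rewrite mulrC => /(mulIf Pij0) ->; rewrite mulrC.
Qed.

Variables (n : nat) (alpha : nat -> R[i]) (H : 'M[R[i]]_n).
Hypothesis alpha_lt1 : forall k, (k < n)%N -> `|alpha k| < 1.
Hypothesis H_unitary : H \is unitarymx.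

(** The diagonal entries both of [eta A] and of [eta] at the adjoint of [A]; also the normalizing
    factor in f_k. *)
Definition defect k : R[i] := sqrtC (1 - `|alpha k| ^+ 2).

Let A := principal (diag_seq alpha) n.
Let E := diag_mx (\row_(k < n) defect k).
Let D := diag_mx (\row_(k < n) (defect k)^-1).
Let K := 1%:M + A^t* *m H.
Let V := mobius_mx A H.

Lemma sqr_defect k : defect k ^+ 2 = 1 - `|alpha k| ^+ 2.
Proof. exact: sqrtCK. Qed.

Lemma defect_gt0 k : (k < n)%N -> 0 < defect k.
Proof. by move=> /alpha_lt1 ak; rewrite sqrtC_gt0 subr_sqr_norm_gt0. Qed.

Let AE : A = diag_mx (\row_(k < n) alpha k). Proof. exact: principal_diag_seq. Qed.

Lemma eta_diag : eta A = E.
Proof.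
rewrite /eta AE adjmx_diag mulmx_diag -(@diag_const_mx _ n 1) -linearB /=.
rewrite sqrtmx_diag; congr diag_mx; apply/rowP => k; rewrite !mxE.
by rewrite -normCK.
Qed.

Lemma eta_adj_diag : eta (A^t*) = E.
Proof.
rewrite /eta trmxCK AE adjmx_diag mulmx_diag -(@diag_const_mx _ n 1) -linearB /=.
rewrite sqrtmx_diag; congr diag_mx; apply/rowP => k; rewrite !mxE.
by rewrite -normCKC.
Qed.

Let DE : D *m E = 1%:M.
Proof.
rewrite mulmx_diag -(@diag_const_mx _ n 1); congr diag_mx; apply/rowP => k.
by rewrite !mxE mulVf // gt_eqF // defect_gt0.
Qed.

Let ED : E *m D = 1%:M. Proof. exact: mulmx1C. Qed.

(** A row x in the kernel satisfies x = - x A^† H, so x and x A^† have the same norm, [H] being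
    unitary. Hence sum_k |x_k|^2 (1 - |alpha_k|^2) = 0 with positive weights, and x = 0. *)
Lemma mobius_den_unit : K \in unitmx.
Proof.
rewrite -row_free_unit -kermx_eq0; apply/eqP/row_matrixP => i; rewrite row0.
set x := row i _.
have xK : x *m K = 0 by rewrite /x -row_mul mulmx_ker row0.
have xH : x = - (x *m A^t* *m H).
  by move/eqP: xK; rewrite mulmxDr mulmx1 mulmxA addr_eq0 => /eqP.
have /matrixP/(_ 0 0) : x *m x^t* = (x *m A^t*) *m (x *m A^t*)^t*.
  rewrite {1 2}xH linearN /= map_mxN mulNmx mulmxN opprK adjmxM mulmxA.
  by rewrite mulmxtVK.
rewrite AE adjmx_diag mul_mx_diag !mxE => eq_norm.
have: \sum_(k < n) `|x 0 k| ^+ 2 * (1 - `|alpha k| ^+ 2) = 0.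
  transitivity (\sum_j x 0 j * (x^t*) j 0 - \sum_j x 0 j * (x^t*) j 0).
    rewrite {2}eq_norm -sumrB; apply: eq_bigr => k _.
    rewrite !mxE rmorphM /= conjCK !normCK; ring.
  by rewrite subrr.
move=> sum0; apply/rowP => k; rewrite [RHS]mxE; apply/eqP.
have ge0 (j : 'I_n) : true -> 0 <= `|x 0 j| ^+ 2 * (1 - `|alpha j| ^+ 2).
  by move=> _; rewrite mulr_ge0 ?exprn_ge0 // ltW // subr_sqr_norm_gt0 // alpha_lt1.
move/eqP: sum0; rewrite psumr_eq0 // => /allP/(_ k (mem_index_enum k)).
rewrite implyTb mulf_eq0 expf_eq0 normr_eq0 => /orP[|] //.
by rewrite gt_eqF // subr_sqr_norm_gt0 // alpha_lt1.
Qed.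

Lemma mobius_mxE : V = D *m (H + A) *m invmx K *m E.
Proof. by rewrite /V /mobius_mx eta_diag eta_adj_diag (invmx_mulmx1 DE). Qed.

(** [A], [D] and [E] are diagonal, so the conditions on [W], whose entries are 1 / (1 -
    |alpha_k|^2), are checked entry by entry. *)
Lemma mobius_unitary : V \is unitarymx.
Proof.
rewrite -trmxC_unitary; apply/unitarymxP; rewrite trmxCK mobius_mxE.
pose W := D *m D.
have D_adj : D^t* = D.
  rewrite adjmx_diag; congr diag_mx; apply/rowP => k; rewrite !mxE.
  by rewrite fmorphV /= conj_sqrtC // ltW // subr_sqr_norm_gt0 ?alpha_lt1.
have E_adj : E^t* = E.
  rewrite adjmx_diag; congr diag_mx; apply/rowP => k; rewrite !mxE.
  by rewrite conj_sqrtC // ltW // subr_sqr_norm_gt0 ?alpha_lt1.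
have WA1 : W - A *m W *m A^t* = 1%:M.
  rewrite /W AE adjmx_diag !mulmx_diag -linearB -(@diag_const_mx _ n 1) /=.
  congr diag_mx; apply/rowP => k; rewrite !mxE.
  have d_gt0 := defect_gt0 (ltn_ord k).
  have -> (x y z : R[i]) : x * x - y * (x * x) * z = (1 - y * z) * x ^+ 2 by ring.
  by rewrite -normCK -sqr_defect -exprMn mulfV ?expr1n // gt_eqF.
have WA : W *m A = A *m W.
  rewrite /W AE !mulmx_diag; congr diag_mx; apply/rowP => k; rewrite !mxE; ring.
have AW1 : W - A^t* *m W *m A = 1%:M.
  rewrite -WA1; congr (_ - _); rewrite /W AE adjmx_diag !mulmx_diag.
  by congr diag_mx; apply/rowP => k; rewrite !mxE; ring.
have AdW : A^t* *m W = W *m A^t*.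
  rewrite /W AE adjmx_diag !mulmx_diag.
  by congr diag_mx; apply/rowP => k; rewrite !mxE; ring.
have HH := adjmx_mul_unitary H_unitary.
apply: (mobius_adj_mul D_adj E_adj DE mobius_den_unit).
exact: (mobius_adj_identity HH WA1 AW1 WA AdW).
Qed.

(** Right multiplication by [D] and then [K] clears the transformation. With y = x D there remains y
    H + y A = l y + l y A^† H, in which the terms containing [H] are then separated from the
    others. *)
Lemma mobius_row_eigen (x : 'rV[R[i]]_n) l :
  x *m V = l *: x <->
  (x *m D) *m (l%:M - A) = (x *m D) *m (1%:M - l *: A^t*) *m H.
Proof.
have -> : x *m V = l *: x <-> (x *m D) *m (H + A) = l *: ((x *m D) *m K).
  rewrite mobius_mxE !mulmxA; split=> [eq_x|->].
    by rewrite !scalemxAl -eq_x -[_ *m E *m D]mulmxA ED mulmx1 mulmxKV ?mobius_den_unit.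
  by rewrite -scalemxAl mulmxK ?mobius_den_unit // -scalemxAl -mulmxA DE mulmx1.
set y := x *m D; rewrite [y *m (_ - A)]mulmxBr mul_mx_scalar.
rewrite [y *m (1%:M - _)]mulmxBr mulmx1 mulmxBl -scalemxAr -scalemxAl.
rewrite mulmxDr [y *m K]mulmxDr mulmx1 mulmxA scalerDr.
move: (y *m H) (y *m A) (l *: y) (l *: _) => X Y Z T.
by split=> /eqP; rewrite -subr_eq => /eqP eq_x; apply/eqP; rewrite -subr_eq -eq_x;
  apply/eqP/rowP => i; rewrite !mxE; ring.
Qed.

End DiagonalMobius.

(** * From the ORF recurrence to the eigenvalue equation *)

Section ParaOrthogonal.
Variables (R : realType) (alpha a : nat -> R[i]) (n : nat) (v : R[i]).
Hypotheses (alpha_lt1 : forall k, `|alpha k| < 1) (a0 : a 0%N = 1).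
Hypotheses (a_lt1 : disk_sequence a) (n_gt0 : (0 < n)%N) (v1 : `|v| = 1).

Let u := mobius (a n) v.
Let b := set_entry a n u.
Let H := principal (hessenberg b) n.
Let V : 'M[R[i]]_n := mobius_mx (principal (diag_seq alpha) n) H.

Lemma mobius_circle_neq0 (w z : R[i]) : `|w| < 1 -> `|z| <= 1 -> 1 + w^* * z != 0.
Proof.
move=> w1 z1; rewrite addrC addr_eq0; apply: contraTneq (w1) => /(congr1 Num.norm).
rewrite normrN normr1 normrM norm_conjC => eq1; apply/negP => {}w1.
suff : `|w| * `|z| < 1 by rewrite eq1 ltxx.
by apply: le_lt_trans w1; rewrite ler_piMr.
Qed.

(** On the circle the denominator equals [(z + w)^* * z], which has the modulus of the numerator. *)
Lemma mobius_circle (w z : R[i]) : `|w| < 1 -> `|z| = 1 -> `|mobius w z| = 1.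
Proof.
move=> w1 z1; have z_le1 : `|z| <= 1 by rewrite z1.
have nz := mobius_circle_neq0 w1 z_le1.
rewrite /mobius normf_div; apply: (canLR (mulfK _)); rewrite ?normr_eq0 // mul1r.
have -> : 1 + w^* * z = (z + w)^* * z.
  by rewrite rmorphD mulrDl /= -normCKC z1 expr1n.
by rewrite normrM norm_conjC z1 mulr1.
Qed.

Let v_le1 : `|v| <= 1. Proof. by rewrite v1. Qed.

Let u1 : `|u| = 1. Proof. exact: mobius_circle (a_lt1 n_gt0) v1. Qed.

Let b_lt k : (k < n)%N -> b k = a k.
Proof. by move=> lt_kn; rewrite /b /set_entry ltn_eqF. Qed.

Let bn : b n = u. Proof. by rewrite /b /set_entry eqxx. Qed.

Let b_le1 k : (k <= n)%N -> `|b k| <= 1.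
Proof.
rewrite leq_eqVlt => /orP[/eqP ->|lt_kn]; first by rewrite bn u1.
rewrite b_lt //; case: k lt_kn => [|k] _; first by rewrite a0 normr1.
by rewrite ltW // a_lt1.
Qed.

Let H_unitary : H \is unitarymx.
Proof. by apply: hessenberg_unitary => //; rewrite ?bn // b_lt. Qed.

Lemma para_mx_unitary : V \is unitarymx.
Proof. by apply: mobius_unitary. Qed.

Local Notation defect := (defect alpha).

(** With x_k read as phi_k(l), column j says zeta_j f_j = sum_k f_k h_(k,j) at l, the denominator
    varpi_j being cleared. *)
Lemma para_mx_eigen (x : 'rV[R[i]]_n) l :
  x *m V = l *: x <->
  forall j : 'I_n, (l - alpha j) * (x 0 j / defect j) =
    \sum_(k < n) (1 - (alpha k)^* * l) * (x 0 k / defect k) * hessenberg b k j.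
Proof.
have -> : x *m V = l *: x <-> _ := mobius_row_eigen _ H_unitary x l; last by [].
set y := _ *m diag_mx _; rewrite principal_diag_seq adjmx_diag.
have -> : l%:M - diag_mx (\row_(k < n) alpha k) = diag_mx (\row_(k < n) (l - alpha k)).
  rewrite -diag_const_mx -linearB /=; congr diag_mx.
  by apply/rowP => k; rewrite !mxE.
set B := 1%:M - _.
have -> : B = diag_mx (\row_(k < n) (1 - (alpha k)^* * l)).
  rewrite /B -diag_const_mx -linearZ -linearB /=; congr diag_mx.
  by apply/rowP => k; rewrite !mxE mulrC.
have yE k : y 0 k = x 0 k / defect k by rewrite /y mul_mx_diag !mxE.
clearbody y.
split=> [/rowP eq_y j|eq_y].
  have := eq_y j; rewrite mul_mx_diag !mxE yE mulrC => ->.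
  by apply: eq_bigr => k _; rewrite mul_mx_diag !mxE yE [_ * (_ - _)]mulrC.
apply/rowP => j; rewrite mul_mx_diag !mxE yE mulrC eq_y.
by apply: eq_bigr => k _; rewrite mul_mx_diag !mxE yE [_ * (_ - _)]mulrC.
Qed.

Section Values.
Variables (p ps : nat -> R[i]) (l : R[i]).

(* The ORF recurrence at the point l; p k and ps k stand for the values of
   phi_k and phi_k^*. *)
Record orf_values : Prop := OrfValues {
  orf_values0 : p 0 = 1;
  orf_star_values0 : ps 0 = 1;
  orf_valuesS : forall k, (1 - (alpha k.+1)^* * l) * p k.+1 =
    e_coef alpha a k.+1 *
      ((l - alpha k) * p k + a k.+1 * ((1 - (alpha k)^* * l) * ps k));
  orf_star_valuesS : forall k, (1 - (alpha k.+1)^* * l) * ps k.+1 =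
    e_coef alpha a k.+1 *
      ((a k.+1)^* * ((l - alpha k) * p k) + (1 - (alpha k)^* * l) * ps k)
}.

Hypothesis orf_p : orf_values.

Let w k := 1 - (alpha k)^* * l.
(** [y k] is the value f_k(l), and [ys k] its analogue built on phi_k^*. *)
Let y k := w k * (p k / defect k).
Let ys k := w k * (ps k / defect k).

Let defect_neq0 k : defect k != 0.
Proof. by rewrite gt_eqF // (@defect_gt0 _ k.+1). Qed.

Let rho_neq0 k : rho a k.+1 != 0.
Proof. by rewrite gt_eqF // rho_gt0 // a_lt1. Qed.

(** The quotient of defects is absorbed by the passage from phi_k to f_k, so that only rho_(k+1)
    survives in the rescaled recurrence. *)
Lemma e_coefE k :
  e_coef alpha a k.+1 = defect k.+1 / (defect k * rho a k.+1).
Proof.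
have varpiE j : (varpi alpha j).[alpha j] = 1 - `|alpha j| ^+ 2.
  by rewrite !hornerE normCKC.
have ge0 j : 0 <= 1 - `|alpha j| ^+ 2 by rewrite subr_sqr_norm_ge0 // ltW.
have rge0 : 0 <= 1 - `|a k.+1| ^+ 2 by rewrite subr_sqr_norm_ge0 // ltW // a_lt1.
have sqrtM (x z : R[i]) : 0 <= x -> sqrtC (x * z) = sqrtC x * sqrtC z.
  exact: rootCMl.
have sqrtV (x : R[i]) : 0 <= x -> sqrtC x^-1 = (sqrtC x)^-1 by exact: rootCV.
rewrite /e_coef !varpiE /= mul1r -mulrA -invfM sqrtM // sqrtV ?mulr_ge0 //.
by rewrite sqrtM.
Qed.

Let yS k : rho a k.+1 * y k.+1 = (l - alpha k) * (p k / defect k) + a k.+1 * ys k.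
Proof.
have := orf_valuesS orf_p k; rewrite e_coefE -/(w _) => eq_p.
rewrite /y [w _ * _]mulrA eq_p /ys -/(w k).
by field; rewrite !defect_neq0 rho_neq0.
Qed.

(** Eliminating (l - alpha_k) p_k between the two recurrences leaves the factor 1 - |a_(k+1)|^2 =
    rho_(k+1)^2 on [ys k]; a division by rho_(k+1) follows. *)
Let ysS k : ys k.+1 = (a k.+1)^* * y k.+1 + rho a k.+1 * ys k.
Proof.
have e1 := yS k; have e2 : rho a k.+1 * ys k.+1 =
    (a k.+1)^* * ((l - alpha k) * (p k / defect k)) + ys k.
  have := orf_star_valuesS orf_p k; rewrite e_coefE -/(w _) => eq_p.
  rewrite /ys [w k.+1 * _]mulrA eq_p -/(w k).
  by field; rewrite !defect_neq0 rho_neq0.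
apply: (mulfI (rho_neq0 k)).
transitivity ((a k.+1)^* * (rho a k.+1 * y k.+1) + rho a k.+1 ^+ 2 * ys k).
  by rewrite e2 e1 sqr_rho normCK; ring.
ring.
Qed.

Let sum_star j : (j < n)%N -> \sum_(k < n) y k * star_coef b j k = ys j.
Proof.
elim: j => [|j IHj] lt_jn.
  rewrite (bigD1 (Ordinal lt_jn)) //= star_coef0 ?b_lt // /delta eqxx mulr1.
  rewrite big1 ?addr0 => [|k]; last first.
    by rewrite -val_eqE star_coef0 ?b_lt // /delta => /negbTE -> ; rewrite mulr0.
  by rewrite /y /ys orf_values0 // orf_star_values0.
rewrite ysS -IHj 1?ltnW // mulr_sumr.
under eq_bigr do rewrite star_coefS mulrDr mulrCA [y _ * (_ * _)]mulrCA.
have -> : rho b j.+1 = rho a j.+1 by rewrite /rho b_lt.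
rewrite b_lt // big_split /=; congr (_ + _).
rewrite (bigD1 (Ordinal lt_jn)) //= /delta eqxx mulr1 big1 ?addr0 // => k.
by rewrite -val_eqE /= => /negbTE ->; rewrite !mulr0.
Qed.

(** [hessenbergE] is summed against the values f_k(l). Columns before the last reproduce [yS]; in
    the last one the unit vector falls outside the range and b_n = u leaves a single term. *)
Let sum_col j : (j < n)%N ->
  \sum_(k < n) y k * hessenberg b k j =
    if j.+1 == n then - u * ys j else (l - alpha j) * (p j / defect j).
Proof.
move=> lt_jn; under eq_bigr do rewrite hessenbergE mulrDr mulrCA [y _ * (_ * _)]mulrCA.
rewrite big_split /= -mulr_sumr sum_star //.
case: eqP => [eq_jn|/eqP neq_jn].
  rewrite eq_jn bn big1 ?addr0 // => k _.
  by rewrite /delta ltn_eqF ?mulr0.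
have lt_j1n : (j.+1 < n)%N by rewrite ltn_neqAle neq_jn.
rewrite (bigD1 (Ordinal lt_j1n)) //= /delta eqxx mulr1 big1 ?addr0 => [|k].
  by rewrite b_lt // /rho b_lt // -/(rho a j.+1) yS; ring.
by rewrite -val_eqE /= => /negbTE ->; rewrite !mulr0.
Qed.

Let columns_row c (j : 'I_n) : (j.+1 < n)%N ->
  (l - alpha j) * ((c *: (\row_(k < n) p k)) 0 j / defect j) =
  \sum_(k < n) w k * ((c *: (\row_(k < n) p k)) 0 k / defect k) * hessenberg b k j.
Proof.
move=> lt_jn; rewrite !mxE -mulrA mulrCA.
have := sum_col (ltn_ord j); rewrite ltn_eqF // => <-.
by rewrite mulr_sumr; apply: eq_bigr => k _; rewrite !mxE /y; ring.
Qed.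

(* Column j of the eigenvalue equation determines x_(j+1) from x_0, .., x_j. *)
Lemma orf_values_eigen_span (x : 'rV[R[i]]_n) :
    (forall k, (k < n)%N -> 1 - (alpha k)^* * l != 0) -> x *m V = l *: x ->
  x = x 0 (Ordinal n_gt0) *: \row_(k < n) p k.
Proof.
move=> w_neq0 /para_mx_eigen xV; set z := _ *: _.
suff eq_xz m : forall k : 'I_n, (k <= m)%N -> x 0 k = z 0 k.
  by apply/rowP => k; apply: (eq_xz n); exact: ltnW.
elim: m => [|m IHm] k.
  rewrite leqn0 => /eqP k0; have -> : k = Ordinal n_gt0 by exact: val_inj.
  by rewrite !mxE /= orf_values0 // mulr1.
rewrite leq_eqVlt => /orP[/eqP k_eq|]; last exact: IHm.
have lt_mn : (m < n)%N by rewrite -ltnS -k_eq ltnS ltnW.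
pose j := Ordinal lt_mn.
have lt_jn : (j.+1 < n)%N by rewrite /= -k_eq.
have hk : hessenberg b k j != 0.
  by rewrite k_eq hessenberg_subdiag /rho b_lt -?k_eq // k_eq rho_neq0.
have: \sum_(i < n) w i * (x 0 i / defect i) * hessenberg b i j
  = \sum_(i < n) w i * (z 0 i / defect i) * hessenberg b i j.
  by rewrite -xV -columns_row // IHm.
rewrite (bigD1 k) //= [RHS](bigD1 k) //= => /eqP.
(* Among the indices i other than k = m + 1, those up to m agree by induction, and those above k
   meet a zero entry of column m. *)
rewrite (eq_bigr (fun i : 'I_n =>
   w i * (z 0 i / defect i) * hessenberg b i j)); last first.
  move=> i neq_ik; have [le_im|lt_mi] := leqP i m; first by rewrite IHm.
  rewrite hessenberg_gt ?mulr0 //= ltn_neqAle lt_mi andbT -k_eq.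
  by rewrite eq_sym.
rewrite (inj_eq (addIr _)) => /eqP /(mulIf hk) /(mulfI (w_neq0 _ (ltn_ord k))).
by apply: mulIf; rewrite invr_eq0.
Qed.

(** By [sum_col] all columns but the last hold identically, and the last one is a nonzero multiple
    of the condition that phi_n + v phi_n^*, cleared of varpi_n, vanishes at l. *)
Lemma orf_values_eigen :
  (\row_(k < n) p k) *m V = l *: (\row_(k < n) p k) <->
  (1 - (alpha n)^* * l) * (p n + v * ps n) = 0.
Proof.
have lt_m : (n.-1 < n)%N by rewrite prednK.
(* The choice of [u] enters here: in phi_n + v phi_n^* the two terms of the recurrence carry the
   factors 1 + conj(a_n) v and a_n + v, whose quotient is [u]. *)
have last_eq : (1 - (alpha n)^* * l) * (p n + v * ps n) =
    e_coef alpha a n * (1 + (a n)^* * v) * defect n.-1 *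
    ((l - alpha n.-1) * (p n.-1 / defect n.-1) + u * ys n.-1).
  have an_neq0 := mobius_circle_neq0 (a_lt1 n_gt0) v_le1.
  rewrite mulrDr mulrCA -[in LHS](prednK n_gt0) orf_valuesS // orf_star_valuesS //.
  rewrite prednK // /ys /u /mobius -/(w _); field.
  by rewrite an_neq0 defect_neq0.
have coef_neq0 : e_coef alpha a n * (1 + (a n)^* * v) * defect n.-1 != 0.
  rewrite -(prednK n_gt0) e_coefE prednK // !mulf_neq0 ?invr_neq0 ?mulf_neq0 //.
  - by rewrite -(prednK n_gt0).
  - exact: mobius_circle_neq0 (a_lt1 n_gt0) v_le1.
have -> : (1 - (alpha n)^* * l) * (p n + v * ps n) = 0 <->
    (l - alpha n.-1) * (p n.-1 / defect n.-1) + u * ys n.-1 = 0.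
  rewrite last_eq; split=> [/eqP|->]; last by rewrite mulr0.
  by rewrite mulf_eq0 (negbTE coef_neq0) => /eqP.
rewrite para_mx_eigen.
have sumE j : (j < n)%N -> \sum_(k < n) (1 - (alpha k)^* * l) *
    ((\row_(k < n) p k) 0 k / defect k) * hessenberg b k j =
    if j.+1 == n then - u * ys j else (l - alpha j) * (p j / defect j).
  by move=> lt_jn; rewrite -sum_col //; apply: eq_bigr => k _; rewrite mxE.
split=> [/(_ (Ordinal lt_m))|eq0 j].
  by rewrite sumE // mxE /= prednK // eqxx mulNr => ->; rewrite addNr.
rewrite sumE // mxE; case: eqP => // eq_jn.
have -> : j = n.-1 :> nat by move/(congr1 predn): eq_jn.
by apply/eqP; rewrite mulNr -addr_eq0 eq0.
Qed.

End Values.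
End ParaOrthogonal.

(** * Unitary matrices with simple spectrum *)

Section SimpleSpectrum.
Variables (R : realType) (n : nat) (V : 'M[R[i]]_n) (p : R[i] -> 'rV[R[i]]_n).
Hypothesis V_unitary : V \is unitarymx.
Hypothesis p_eigen : forall l (x : 'rV[R[i]]_n),
  `|l| = 1 -> x *m V = l *: x -> exists c, x = c *: p l.

(** The Christoffel number at l, that is, the quadrature mass once [p l] is the row of the
    phi_k(l). *)
Definition christoffel l : R[i] := (\sum_k `|p l 0 k| ^+ 2)^-1.

Let P := spectralmx V.
Let d i := spectral_diag V 0 i.

Let P_unitary : P \is unitarymx. Proof. exact: spectral_unitarymx. Qed.

Let VE : P *m V = diag_mx (spectral_diag V) *m P.
Proof.
have normal_V : V \is normalmx.
  apply/normalmxP; rewrite (unitarymxP V_unitary).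
  by rewrite adjmx_mul_unitary.
rewrite {1}(orthomx_spectralP normal_V) -mulmxA mulKVmx //.
exact: spectral_unit.
Qed.

Let PP : P^t* *m P = 1%:M. Proof. exact: adjmx_mul_unitary. Qed.

Let d_norm i : `|d i| = 1.
Proof.
have: diag_mx (spectral_diag V) \is unitarymx.
  have -> : diag_mx (spectral_diag V) = P *m V *m P^t*.
    by rewrite VE mulmxtVK.
  have P_tr : P^t* \is unitarymx by rewrite trmxC_unitary.
  exact: mul_unitarymx (mul_unitarymx P_unitary V_unitary) P_tr.
move/unitarymxP/matrixP/(_ i i); rewrite adjmx_diag mulmx_diag !mxE eqxx !mulr1n.
by rewrite -normCK => /eqP; rewrite sqrp_eq1 ?normr_ge0 // => /eqP.
Qed.

Let row_eigen i : row i P *m V = d i *: row i P.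
Proof. by rewrite -row_mul VE; apply/rowP => j; rewrite mul_diag_mx !mxE. Qed.

(** Row i of the diagonalizing unitary [P] is c_i p(d_i), and its unit norm makes |c_i|^2 the
    Christoffel number. The three sums are then the entries of P^† P = 1, of P^† P V = V, and the
    orthogonality of the rows of [P]. *)
Lemma unitary_simple_spectrum : exists d : 'I_n -> R[i],
  [/\ injective d, forall i, `|d i| = 1,
      forall l, eigenvalue V l <-> exists i, l = d i,
      forall i, p (d i) *m V = d i *: p (d i) &
   [/\ forall j k, \sum_i christoffel (d i) * ((p (d i) 0 j)^* * p (d i) 0 k) =
                     (j == k)%:R,
       forall j k, \sum_i christoffel (d i) * ((p (d i) 0 j)^* * (d i * p (d i) 0 k)) =
                     V j k &
       forall i j, \sum_k christoffel (d i) * ((p (d i) 0 k)^* * p (d j) 0 k) =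
                     (i == j)%:R]].
Proof.
exists d.
have /(_ _)/cid c_ i : exists c, row i P = c *: p (d i) by exact: p_eigen.
pose c i := projT1 (c_ i).
have cP i k : P i k = c i * p (d i) 0 k.
  by have /rowP/(_ k) := projT2 (c_ i); rewrite !mxE.
have dotP i j : c i * (c j)^* * \sum_k (p (d j) 0 k)^* * p (d i) 0 k = (i == j)%:R.
  have /unitarymxP/matrixP/(_ i j) := P_unitary; rewrite !mxE => <-.
  rewrite mulr_sumr; apply: eq_bigr => k _; rewrite !mxE !cP rmorphM /=; ring.
have dotE i : \sum_k (p (d i) 0 k)^* * p (d i) 0 k = \sum_k `|p (d i) 0 k| ^+ 2.
  by apply: eq_bigr => k _; rewrite normCKC.
have cn1 i : `|c i| ^+ 2 * (\sum_k `|p (d i) 0 k| ^+ 2) = 1.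
  by rewrite -dotE normCK dotP eqxx.
have c_neq0 i : c i != 0.
  apply: contra_eq_neq (cn1 i) => ->.
  by rewrite normr0 expr0n mul0r eq_sym oner_eq0.
have cn i : christoffel (d i) = `|c i| ^+ 2.
  have N0 : \sum_k `|p (d i) 0 k| ^+ 2 != 0.
    by apply: contra_eq_neq (cn1 i) => ->; rewrite mulr0 eq_sym oner_eq0.
  by apply: (mulIf N0); rewrite mulVf // cn1.
(* A repeated eigenvalue would make two orthogonal nonzero rows of [P] multiples of one vector. *)
have d_inj : injective d.
  move=> i j dij; apply/eqP; apply: contraT => neq_ij.
  have := dotP i j; rewrite (negbTE neq_ij) -dij dotE => /eqP.
  rewrite !mulf_eq0 conjC_eq0 !(negbTE (c_neq0 _)) /= => /eqP N0.
  by have /eqP := cn1 i; rewrite N0 mulr0 eq_sym oner_eq0.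
have pV i : p (d i) *m V = d i *: p (d i).
  have rowE : row i P = c i *: p (d i) by apply/rowP => k; rewrite !mxE cP.
  have := row_eigen i; rewrite rowE -scalemxAl scalerA mulrC -scalerA.
  by move/(scalerI (c_neq0 i)).
split=> //; first move=> l; last split.
- split=> [/eigenvalueP[x xV x_neq0]|[i ->]]; last first.
    apply/eigenvalueP; exists (p (d i)) => //; apply: contra_eq_neq (cn1 i) => ->.
    by rewrite big1 ?mulr0 1?eq_sym ?oner_eq0 // => k _; rewrite mxE normr0 expr0n.
  (* Coordinates of the eigenvector in the rows of [P]: any nonzero coordinate i forces l = d_i. *)
  pose z := x *m P^t*.
  have zx : z *m P = x by rewrite /z -mulmxA PP mulmx1.
  have zd : z *m diag_mx (spectral_diag V) = l *: z.
    rewrite -[LHS](mulmxtVK _ P_unitary) -[_ *m _ *m P]mulmxA -VE mulmxA zx xV.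
    by rewrite -scalemxAl.
  clearbody z; have /rV0Pn[i zi] : z != 0.
    by apply: contra_neq x_neq0 => z0; rewrite -zx z0 mul0mx.
  exists i; have /rowP/(_ i) := zd; rewrite mul_mx_diag !mxE mulrC.
  by move/(mulIf zi) => <-.
- move=> j k; transitivity ((P^t* *m P) j k); last by rewrite PP !mxE.
  rewrite !mxE; apply: eq_bigr => i _; rewrite !mxE !cP cn normCK rmorphM /=; ring.
- move=> j k; transitivity ((P^t* *m P *m V) j k); last by rewrite PP mul1mx.
  rewrite -mulmxA VE !mxE; apply: eq_bigr => i _.
  rewrite mul_diag_mx !mxE !cP cn normCK rmorphM /= -/(d i); ring.
- move=> i j; rewrite -mulr_sumr; have [<-|neq_ij] := eqVneq i j.
    by rewrite dotE cn cn1.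
  have := dotP j i; rewrite eq_sym (negbTE neq_ij) => /eqP.
  rewrite !mulf_eq0 conjC_eq0 !(negbTE (c_neq0 _)) /= => /eqP ->.
  by rewrite mulr0.
Qed.

End SimpleSpectrum.

(** * Numerators of the ORF and the characteristic polynomial *)

Section OrfPolynomials.
Variables (R : realType) (alpha a : nat -> R[i]).

(* pi_n phi_n and pi_n phi_n^* *)
Fixpoint orf_poly n : {poly R[i]} * {poly R[i]} :=
  if n is m.+1 then
    let x := varpi_star alpha m * (orf_poly m).1 in
    let y := varpi alpha m * (orf_poly m).2 in
    (e_coef alpha a n *: (x + a n *: y), e_coef alpha a n *: ((a n)^* *: x + y))
  else (1, 1).

Lemma pi_polyS n : pi_poly alpha n.+1 = pi_poly alpha n * varpi alpha n.+1.
Proof. by rewrite /pi_poly big_nat_recr. Qed.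

Lemma horner_varpi n l : (varpi alpha n).[l] = 1 - (alpha n)^* * l.
Proof. by rewrite !hornerE. Qed.

Lemma horner_varpi_star n l : (varpi_star alpha n).[l] = l - alpha n.
Proof. exact: hornerXsubC. Qed.

Lemma size_varpi n : (size (varpi alpha n) <= 2)%N.
Proof.
rewrite (leq_trans (size_polyD _ _)) // size_polyN geq_max size_poly1 /=.
by rewrite (leq_trans (size_scale_leq _ _)) // size_polyX.
Qed.

Lemma size_orf_poly n :
  (size (orf_poly n).1 <= n.+1)%N /\ (size (orf_poly n).2 <= n.+1)%N.
Proof.
elim: n => [|n [IH1 IH2]] /=; first by rewrite size_poly1.
have sx : (size (varpi_star alpha n * (orf_poly n).1)%R <= n.+2)%N.
  by rewrite (leq_trans (size_polyMleq _ _)) // size_XsubC.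
have sy : (size (varpi alpha n * (orf_poly n).2)%R <= n.+2)%N.
  rewrite (leq_trans (size_polyMleq _ _)) // -subn1 leq_subLR.
  exact: leq_add (size_varpi n) IH2.
have sum_le (f g : {poly R[i]}) : (size f <= n.+2)%N -> (size g <= n.+2)%N ->
    (size (f + g)%R <= n.+2)%N.
  by move=> sf sg; rewrite (leq_trans (size_polyD _ _)) // geq_max sf.
have scale_le c (f : {poly R[i]}) : (size f <= n.+2)%N -> (size (c *: f)%R <= n.+2)%N.
  by move=> sf; rewrite (leq_trans (size_scale_leq _ _)).
by split; apply: (scale_le); apply: sum_le => //; apply: scale_le.
Qed.

Lemma orf_poly_values l : (forall k, (varpi alpha k).[l] != 0) ->
  orf_values alpha a (fun k => (orf_poly k).1.[l] / (pi_poly alpha k).[l])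
    (fun k => (orf_poly k).2.[l] / (pi_poly alpha k).[l]) l.
Proof.
move=> w_neq0.
have pi_neq0 k : (pi_poly alpha k).[l] != 0.
  elim: k => [|k IHk]; first by rewrite /pi_poly big_geq // hornerC oner_eq0.
  by rewrite pi_polyS hornerM mulf_neq0.
split=> [||k|k]; rewrite ?pi_polyS /=; try by rewrite /pi_poly big_geq // hornerC divr1.
all: rewrite -!horner_varpi -!horner_varpi_star !(hornerM, hornerZ, hornerD).
all: by field; rewrite pi_neq0 -hornerD; exact: w_neq0.
Qed.

Section Para.
Variables (n : nat) (v : R[i]).
Hypotheses (alpha_lt1 : forall k, `|alpha k| < 1) (a0 : a 0%N = 1).
Hypotheses (a_lt1 : disk_sequence a) (n_gt0 : (0 < n)%N) (v1 : `|v| = 1).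

Let u := mobius (a n) v.
Let V : 'M[R[i]]_n := mobius_mx (principal (diag_seq alpha) n)
  (principal (hessenberg (set_entry a n u)) n).
Let q := (orf_poly n).1 + v *: (orf_poly n).2.
Let p l : 'rV[R[i]]_n := \row_(k < n) ((orf_poly k).1.[l] / (pi_poly alpha k).[l]).

Lemma varpi_neq0 k l : `|l| <= 1 -> (varpi alpha k).[l] != 0.
Proof.
move=> l1; rewrite horner_varpi -mulNr -rmorphN; apply: mobius_circle_neq0 => //.
by rewrite normrN.
Qed.

Lemma pi_poly_neq0 k l : `|l| <= 1 -> (pi_poly alpha k).[l] != 0.
Proof.
move=> l1; elim: k => [|k IHk]; first by rewrite /pi_poly big_geq // hornerC oner_eq0.
by rewrite pi_polyS hornerM mulf_neq0 // varpi_neq0.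
Qed.

(** No varpi_k vanishes on the closed disk, so there [orf_values_eigen] concerns [q] alone. The
    point l = 0, off the circle, serves to show that [q] is nonzero. *)
Lemma para_poly_root_eigen l : `|l| <= 1 -> root q l <-> p l *m V = l *: p l.
Proof.
move=> l1; have vals := orf_poly_values (fun k => varpi_neq0 k l1).
have -> : p l *m V = l *: p l <-> _ := orf_values_eigen alpha_lt1 a0 a_lt1 n_gt0 v1 vals.
rewrite -horner_varpi mulrA -mulrDl.
have -> : (orf_poly n).1.[l] + v * (orf_poly n).2.[l] = q.[l] by rewrite !hornerE.
split=> [/rootP ->|/eqP]; first by rewrite mul0r mulr0.
rewrite !mulf_eq0 (negbTE (varpi_neq0 _ l1)) invr_eq0.
by rewrite (negbTE (pi_poly_neq0 _ l1)) orbF.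
Qed.

Lemma para_left_eigen l (x : 'rV[R[i]]_n) :
  `|l| <= 1 -> x *m V = l *: x -> exists c, x = c *: p l.
Proof.
move=> l1 xV; have vals := orf_poly_values (fun k => varpi_neq0 k l1).
have w_neq0 k : (k < n)%N -> 1 - (alpha k)^* * l != 0.
  by rewrite -horner_varpi varpi_neq0.
exists (x 0 (Ordinal n_gt0)).
exact: (orf_values_eigen_span alpha_lt1 a0 a_lt1 n_gt0 v1 vals w_neq0 xV).
Qed.

(* q is nonzero because 0 is not an eigenvalue of the unitary matrix V. *)
Lemma para_poly_char_poly (d : 'I_n -> R[i]) : injective d ->
    (forall i, `|d i| = 1) -> (forall l, eigenvalue V l <-> exists i, l = d i) ->
    (forall i, p (d i) *m V = d i *: p (d i)) ->
  exists2 c, c != 0 & q = c *: char_poly V.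
Proof.
move=> d_inj d_norm eigenV pV.
pose rs := [seq d i | i : 'I_n].
have rs_uniq : uniq_roots rs by rewrite uniq_rootsE map_inj_uniq ?enum_uniq.
have size_rs : size rs = n by rewrite size_map size_enum_ord.
have V_unit : V \in unitmx.
  by apply: unitarymx_unit; exact: para_mx_unitary.
have q_neq0 : q != 0.
  apply/eqP => q0; have : root q 0 by rewrite q0 root0.
  move/(para_poly_root_eigen (l := 0)); rewrite normr0 scale0r => /(_ ler01) pV0.
  (* This contradicts the entry of index 0, which is phi_0(0) = 1. *)
  have : p 0 = 0 by rewrite -[LHS](mulmxK V_unit) pV0 mul0mx.
  move/rowP/(_ (Ordinal n_gt0)); rewrite !mxE /= hornerC /pi_poly big_geq // hornerC.
  by rewrite divr1 => /eqP; rewrite oner_eq0.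
have roots_q : all (root q) rs.
  by apply/allP => _ /mapP[i _ ->]; apply/para_poly_root_eigen; rewrite ?d_norm.
have size_q : size q = (size rs).+1.
  have rs_lt : (size rs < size q)%N by rewrite max_poly_roots // -uniq_rootsE.
  apply/eqP; rewrite eqn_leq rs_lt size_rs andbT.
  have [s1 s2] := size_orf_poly n.
  rewrite (leq_trans (size_polyD _ _)) // geq_max s1 /=.
  by rewrite (leq_trans (size_scale_leq _ _)).
exists (lead_coef q); first by rewrite lead_coef_eq0.
rewrite {1}(all_roots_prod_XsubC size_q roots_q rs_uniq); congr (_ *: _).
have roots_V : all (root (char_poly V)) rs.
  by apply/allP => _ /mapP[i _ ->]; rewrite -eigenvalue_root_char; apply/eigenV; exists i.
rewrite [RHS](all_roots_prod_XsubC _ roots_V rs_uniq) ?size_char_poly ?size_rs //.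
by rewrite (monicP (char_poly_monic V)) scale1r.
Qed.

End Para.
End OrfPolynomials.

(** * Rational functions *)

Section RationalFunctions.
Variable R : realType.
Implicit Types (f : ratfun R) (p q : {poly R[i]}).
Local Notation tofrac := (@FracField.tofrac {poly R[i]}).

Lemma coprimep_rnum_rden f : coprimep (rnum f) (rden f).
Proof.
have den_neq0 : (repr f).2 != 0 by exact: denom_ratioP.
by rewrite /rnum /rden coprimep_div_gcd // den_neq0 orbT.
Qed.

Lemma pi_ratio (x : {ratio {poly R[i]}}) :
  (\pi_({fraction {poly R[i]}}) x)%qT = tofrac x.1 / tofrac x.2.
Proof.
have den_neq0 : x.2 != 0 by exact: denom_ratioP.
apply: (canRL (mulfK _)); first by rewrite tofrac_eq0.
unlock FracField.tofrac; rewrite -[LHS]FracField.pi_mul; apply/eqP.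
rewrite [_ == _]FracField.equivf_def.
by rewrite /FracField.mulf !numden_Ratio ?oner_neq0 ?mulf_neq0 ?oner_neq0 // !mulr1 mulrC.
Qed.

Lemma ratfun_repr f : f = tofrac (repr f).1 / tofrac (repr f).2.
Proof. by rewrite -pi_ratio reprK. Qed.

(** The reduced fraction comes from an unspecified representative, so it is compared with a given
    presentation only by cross-multiplication, after cancelling the gcd. *)
Lemma rnum_rden_cross f p q : q != 0 -> f = tofrac p / tofrac q ->
  rnum f * q = p * rden f.
Proof.
move=> q_neq0; rewrite {1}(ratfun_repr f).
set g := gcdp (repr f).1 (repr f).2.
have den_neq0 : (repr f).2 != 0 by exact: denom_ratioP.
have g_neq0 : g != 0 by rewrite gcdp_eq0 negb_and den_neq0 orbT.
move/eqP; rewrite eqr_div ?tofrac_eq0 // -!tofracM tofrac_eq => /eqP eq_pq.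
apply: (mulIf g_neq0); rewrite mulrAC -[RHS]mulrA.
by rewrite /rnum /rden -/g !divpK ?dvdp_gcdl ?dvdp_gcdr.
Qed.

Lemma root_rnum_rden f l : root (rnum f) l -> (rden f).[l] != 0.
Proof. by move=> rl; apply: coprimep_root rl; exact: coprimep_rnum_rden. Qed.

Section Quotient.
Variables (f : ratfun R) (p q : {poly R[i]}) (l : R[i]).
Hypotheses (q_neq0 : q != 0) (fE : f = tofrac p / tofrac q).

(** By coprimality a root of [rnum f] is not a root of [rden f], so the cross-multiplied identity
    passes the root to [p]. *)
Lemma is_zero_root : is_zero f l -> root p l.
Proof.
move=> fl; have den_l := root_rnum_rden fl.
have /(congr1 (horner^~ l)) := rnum_rden_cross q_neq0 fE.
by rewrite !hornerM (rootP fl) mul0r => /esym /eqP; rewrite mulf_eq0 (negbTE den_l) orbF.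
Qed.

Hypothesis ql : q.[l] != 0.

Lemma root_is_zero : root p l -> is_zero f l.
Proof.
move=> pl; have /(congr1 (horner^~ l)) := rnum_rden_cross q_neq0 fE.
by rewrite !hornerM (rootP pl) mul0r => /eqP; rewrite mulf_eq0 (negbTE ql) orbF.
Qed.

Lemma reval_quotient : reval f l = p.[l] / q.[l].
Proof.
have /(congr1 (horner^~ l)) := rnum_rden_cross q_neq0 fE; rewrite !hornerM => cross.
(* A root of [rden f] would, as q(l) is nonzero, be a root of [rnum f] too, against coprimality. *)
have den_l : (rden f).[l] != 0.
  apply: contraT => /negPn/eqP den0; have : root (rnum f) l.
    by move/eqP: cross; rewrite den0 mulr0 mulf_eq0 (negbTE ql) orbF.
  by move/root_rnum_rden; rewrite den0 eqxx.
by apply/eqP; rewrite /reval eqr_div // cross.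
Qed.

End Quotient.

(** The numerator and denominator chosen for 1 are equal and coprime, hence one nonzero constant
    whose value is unspecified; it cancels after conjugation. *)
Lemma lower_star1 : lower_star (1 : ratfun R) = 1.
Proof.
have eq_nd : rnum (1 : ratfun R) = rden 1.
  have := rnum_rden_cross (f := 1) (p := 1) (q := 1) (oner_neq0 _).
  by rewrite mulr1 mul1r; apply; rewrite tofrac1 divr1.
have rden_const : rden (1 : ratfun R) %= 1.
  by have := coprimep_rnum_rden 1; rewrite eq_nd coprimepp -size_poly_eq1.
have [c c_neq0 rdenE] : exists2 c, c != 0 & rden (1 : ratfun R) = c%:P.
  by apply/size_poly1P; rewrite size_poly_eq1.
rewrite /lower_star eq_nd rdenE divff // map_polyE polyseqC c_neq0 horner_Poly /=.
by rewrite mul0r add0r tofrac_eq0 polyC_eq0 conjC_eq0.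
Qed.

(** The recurrence for phi over a common denominator: [w], [w'], [d] stand for varpi_k, varpi_(k+1),
    pi_k, and [P], [Q] for the two numerators. *)
Lemma quotient_rec1 (F : fieldType) (e w w' d x c P Q : F) :
    w != 0 -> w' != 0 -> d != 0 ->
  e * (w / w') * (x / w * (P / d) + c * (Q / d)) = e * (x * P + c * (w * Q)) / (d * w').
Proof. by move=> w0 w'0 d0; field; rewrite ?w0 ?w'0 ?d0. Qed.

Lemma quotient_rec2 (F : fieldType) (e w w' d x c P Q : F) :
    w != 0 -> w' != 0 -> d != 0 ->
  e * (w / w') * (c * (x / w * (P / d)) + Q / d) = e * (c * (x * P) + w * Q) / (d * w').
Proof. by move=> w0 w'0 d0; field; rewrite ?w0 ?w'0 ?d0. Qed.

Section ORF.
Variables (mu : {measure set (borelC R) -> \bar R}) (alpha a : nat -> R[i]).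
Variable phi : nat -> ratfun R.
Hypothesis orf : is_ORF mu alpha phi a.

Lemma varpi_poly_neq0 k : varpi alpha k != 0.
Proof.
apply/eqP => /(congr1 (horner^~ 0)) /eqP.
by rewrite horner_varpi horner0 mulr0 subr0 oner_eq0.
Qed.

Lemma pi_poly_poly_neq0 k : pi_poly alpha k != 0.
Proof. by rewrite /pi_poly prodf_seq_neq0; apply/allP => j _; exact: varpi_poly_neq0. Qed.

Lemma orf_polyE k :
  phi k = tofrac (orf_poly alpha a k).1 / tofrac (pi_poly alpha k) /\
  upper_star alpha k (phi k) = tofrac (orf_poly alpha a k).2 / tofrac (pi_poly alpha k).
Proof.
elim: k => [|k [IH1 IH2]].
  rewrite (orf0 orf) /upper_star /blaschke /pi_poly !big_geq // lower_star1.
  by rewrite tofrac1 divr1 mul1r.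
have [-> ->] := orf_rec orf (ltn0Sn k).
rewrite /= IH2 IH1 /zeta pi_polyS.
have pi_neq0 : tofrac (pi_poly alpha k) != 0 by rewrite tofrac_eq0 pi_poly_poly_neq0.
have w_neq0 j : tofrac (varpi alpha j) != 0 by rewrite tofrac_eq0 varpi_poly_neq0.
move: pi_neq0 (w_neq0 k) (w_neq0 k.+1) => {IH1 IH2 w_neq0}.
move: (varpi _ k) (varpi _ k.+1) (varpi_star _ k) (pi_poly _ k) => w w' x d.
move: (orf_poly _ _ k).1 (orf_poly _ _ k).2 => P Q d_neq0 w_neq0 w'_neq0.
rewrite -!mul_polyC !(tofracM, tofracD).
rewrite /ratC; move: d_neq0 w_neq0 w'_neq0.
move: (tofrac _%:P) (tofrac _%:P) (tofrac _%:P) (tofrac w) (tofrac w') (tofrac x).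
move: (tofrac d) (tofrac P) (tofrac Q) => d' P' Q' c1 c2 e y y' x' d0 y0 y'0.
split; first exact (quotient_rec1 e x' c2 P' Q' y0 y'0 d0).
exact (quotient_rec2 e x' c1 P' Q' y0 y'0 d0).
Qed.

Lemma para_orfE n v : para_orf alpha phi n v =
  tofrac ((orf_poly alpha a n).1 + v *: (orf_poly alpha a n).2) / tofrac (pi_poly alpha n).
Proof.
have [E1 E2] := orf_polyE n.
by rewrite /para_orf E2 E1 /ratC -!mul_polyC !(tofracM, tofracD) mulrDl mulrA.
Qed.

End ORF.
End RationalFunctions.

(** * Finitely supported measures on the circle *)

Section ComplexMeasurability.
Import numFieldNormedType.Exports.
Variable R : realType.
Implicit Types (D : set (borelC R)) (f g : borelC R -> R[i]).

Lemma normC_real (x : R[i]) : (normC x)%:C = `|x|.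
Proof. by rewrite /normC RRe_real // normr_real. Qed.

(** Preimages of open intervals are open by the Lipschitz bound, and open intervals generate the
    Borel sets of the line. *)
Lemma lipschitz_measurable D (g : R[i] -> R) :
  (forall x y, `|g x - g y|%:C <= `|x - y|) -> measurable_fun D (g : borelC R -> R).
Proof.
move=> g_lip; apply: measurable_funTS.
apply: (measurability _ (RGenOpens.measurableE R)).
move=> _ [_ [a [b ->]] <-]; rewrite setTI; apply: sub_gen_smallest.
rewrite openE => z /= gz.
have /nbhs_ballP[e e0 eU] : nbhs (g z) (`]a, b[%classic : set R).
  by apply: open_nbhs_nbhs; split => //; exact: interval_open.
apply/nbhs_ballP; exists e%:C; first by rewrite /= ltcR.
move=> y; rewrite -ball_normE /= => zy; apply: eU.
by rewrite -ball_normE /= -ltcR (le_lt_trans (g_lip _ _)).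
Qed.

Lemma measurable_Re D : measurable_fun D (fun z : borelC R => complex.Re z).
Proof.
apply: lipschitz_measurable => x y.
have -> : complex.Re x - complex.Re y = complex.Re (x - y).
  by case: x y => [? ?] [? ?].
exact: normc_ge_Re.
Qed.

Lemma measurable_Im D : measurable_fun D (fun z : borelC R => complex.Im z).
Proof.
apply: lipschitz_measurable => x y.
have -> : complex.Im x - complex.Im y = complex.Im (x - y).
  by case: x y => [? ?] [? ?].
have i1 : `|'i%C : R[i]| = 1 by rewrite normc_def /= expr0n expr1n add0r sqrtr1.
(* The imaginary part is, up to sign, the real part after multiplication by i, which preserves the
   modulus. *)
by have := normc_ge_Re ((x - y) * 'i%C); rewrite ReiNIm normrN normrM i1 mulr1.
Qed.

Definition cmeasurable D f :=
  measurable_fun D (fun z => complex.Re (f z)) /\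
  measurable_fun D (fun z => complex.Im (f z)).

Lemma cmeasurable_cst D c : cmeasurable D (fun=> c).
Proof. by split; exact: measurable_cst. Qed.

Lemma cmeasurable_id D : cmeasurable D (fun z => z).
Proof. by split; [exact: measurable_Re|exact: measurable_Im]. Qed.

Lemma cmeasurableD D f g :
  cmeasurable D f -> cmeasurable D g -> cmeasurable D (fun z => f z + g z).
Proof.
move=> [fr fi] [gr gi]; split.
  rewrite (_ : (fun _ => _) = (fun z => complex.Re (f z)) \+ (fun z => complex.Re (g z))).
    exact: measurable_funD.
  by apply/funext => z /=; case: (f z) (g z) => [? ?] [? ?].
rewrite (_ : (fun _ => _) = (fun z => complex.Im (f z)) \+ (fun z => complex.Im (g z))).
  exact: measurable_funD.
by apply/funext => z /=; case: (f z) (g z) => [? ?] [? ?].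
Qed.

Lemma cmeasurableM D f g :
  cmeasurable D f -> cmeasurable D g -> cmeasurable D (fun z => f z * g z).
Proof.
move=> [fr fi] [gr gi]; split.
  rewrite (_ : (fun _ => _) =
    ((fun z => complex.Re (f z)) \* (fun z => complex.Re (g z))) \-
    ((fun z => complex.Im (f z)) \* (fun z => complex.Im (g z)))).
    by apply: measurable_funB; exact: measurable_funM.
  by apply/funext => z /=; case: (f z) (g z) => [? ?] [? ?].
rewrite (_ : (fun _ => _) =
  ((fun z => complex.Re (f z)) \* (fun z => complex.Im (g z))) \+
  ((fun z => complex.Im (f z)) \* (fun z => complex.Re (g z)))).
  by apply: measurable_funD; exact: measurable_funM.
by apply/funext => z /=; case: (f z) (g z) => [? ?] [? ?].
Qed.

Lemma cmeasurable_conj D f : cmeasurable D f -> cmeasurable D (fun z => (f z)^*).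
Proof.
move=> [fr fi]; split.
  rewrite (_ : (fun _ => _) = (fun z => complex.Re (f z))) //.
  by apply/funext => z /=; case: (f z).
rewrite (_ : (fun _ => _) = \- (fun z => complex.Im (f z))).
  exact: measurable_funN.
by apply/funext => z /=; case: (f z).
Qed.

Lemma measurable_fun_inv D (h : borelC R -> R) : measurable D ->
  (forall z, D z -> h z != 0) -> measurable_fun D h -> measurable_fun D (fun z => (h z)^-1).
Proof.
move=> mD h0 mh; apply: (@measurable_comp _ _ _ _ _ _ (~` [set 0 : R]) (fun x => x^-1)) => //.
- by apply: measurableC; exact: measurable_set1.
- by move=> _ [z Dz <-]; exact/eqP/h0.
apply: open_continuous_measurable_fun.
  exact/closed_openC/accessible_closed_set1/hausdorff_accessible/Rhausdorff.
by move=> x /[!inE]/eqP x0; exact: inv_continuous.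
Qed.

Lemma normC_sqr (x : R[i]) : normC x ^+ 2 = complex.Re x ^+ 2 + complex.Im x ^+ 2.
Proof.
by rewrite /normC normc_def /= sqr_sqrtr // addr_ge0 ?sqr_ge0.
Qed.

Lemma measurable_normC_sqr D f : cmeasurable D f ->
  measurable_fun D (fun z => normC (f z) ^+ 2).
Proof.
move=> [fr fi]; under eq_fun do rewrite normC_sqr.
by apply: measurable_funD; exact: measurable_funX.
Qed.

(** The inverse of f is its conjugate divided by |f|^2, so only a real inverse is needed. *)
Lemma cmeasurableV D f : measurable D -> (forall z, D z -> f z != 0) ->
  cmeasurable D f -> cmeasurable D (fun z => (f z)^-1).
Proof.
move=> mD f0 mf; have [fr fi] := mf.
have mn : measurable_fun D (fun z => (normC (f z) ^+ 2)^-1).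
  apply: measurable_fun_inv => //; last exact: measurable_normC_sqr.
  move=> z /f0; apply: contra; rewrite sqrf_eq0 => /eqP n0.
  by rewrite -normr_eq0 -normC_real n0.
split.
  rewrite (_ : (fun _ => _) =
    (fun z => complex.Re (f z)) \* (fun z => (normC (f z) ^+ 2)^-1)).
    exact: measurable_funM.
  by apply/funext => z /=; rewrite normC_sqr; case: (f z).
rewrite (_ : (fun _ => _) =
  \- ((fun z => complex.Im (f z)) \* (fun z => (normC (f z) ^+ 2)^-1))).
  by apply: measurable_funN; exact: measurable_funM.
by apply/funext => z /=; rewrite normC_sqr; case: (f z).
Qed.

Lemma cmeasurable_horner D (p : {poly R[i]}) : cmeasurable D (fun z => p.[z]).
Proof.
elim/poly_ind: p => [|p c IHp].
  by under eq_fun do rewrite horner0; exact: cmeasurable_cst.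
under eq_fun do rewrite hornerMXaddC.
apply: cmeasurableD (cmeasurable_cst _ _).
exact: cmeasurableM IHp (cmeasurable_id _).
Qed.

Lemma measurable_borelC1 (z : borelC R) : measurable [set z].
Proof.
rewrite (_ : [set z] = (fun w : borelC R => complex.Re w) @^-1` [set complex.Re z] `&`
  (fun w : borelC R => complex.Im w) @^-1` [set complex.Im z]); last first.
  by apply/seteqP; split=> [_ ->|[x y] /= [-> ->]] //; case: z.
by apply: measurableI; rewrite -[_ @^-1` _]setTI;
  [apply: measurable_Re|apply: measurable_Im] => //; exact: measurable_set1.
Qed.

Lemma measurable_circle : measurable (@circle R).
Proof.
rewrite (_ : @circle R = (fun z : borelC R => normC z ^+ 2) @^-1` [set 1]).
  rewrite -[_ @^-1` _]setTI.
  by apply: (measurable_normC_sqr (cmeasurable_id _)) => //; exact: measurable_set1.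
apply/seteqP; split=> z /=; rewrite /circle /=.
  by rewrite /normC => ->; rewrite /= expr1n.
move/eqP; rewrite sqrp_eq1 => [/eqP n1|]; first by rewrite -normC_real n1.
by rewrite -lecR normC_real; exact: normr_ge0.
Qed.

End ComplexMeasurability.

Section FiniteAtomic.
Variables (R : realType) (z : nat -> borelC R) (w : nat -> {nonneg R}) (N : nat).

Let nu : {measure set (borelC R) -> \bar R} :=
  msum (fun k => mscale (w k) (dirac (z k))) N.

Lemma atomicE A : nu A = (\sum_(k < N) (w k)%:num%:E * \d_(z k) A)%E.
Proof. by []. Qed.

Variable D : set (borelC R).
Hypotheses (mD : measurable D) (zD : forall k, (k < N)%N -> D (z k)).

Lemma ge0_integral_atomic (f : borelC R -> \bar R) :
    (forall x, D x -> (0 <= f x)%E) -> measurable_fun D f ->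
  (\int[nu]_(x in D) f x = \sum_(k < N) (w k)%:num%:E * f (z k))%E.
Proof.
move=> f0 mf; rewrite ge0_integral_measure_sum //; apply: eq_bigr => k _.
rewrite ge0_integral_mscale // integral_dirac // diracE mem_set ?mul1e //.
exact: zD.
Qed.

Lemma Rintegral_atomic (f : borelC R -> R) : measurable_fun D f ->
  \int[nu]_(x in D) f x = \sum_(k < N) (w k)%:num * f (z k).
Proof.
move=> mf; have mEf : measurable_fun D (EFin \o f) by exact/measurable_EFinP.
(* Positive and negative parts are integrated separately and recombined through x = max(x, 0) -
   max(-x, 0). *)
rewrite /Rintegral integralE !ge0_integral_atomic //; try by
  [exact: measurable_funepos|exact: measurable_funeneg].
rewrite (eq_bigr (fun k : 'I_N => ((w k)%:num * Num.max (f (z k)) 0)%:E)) ?sumEFin; last first.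
  by move=> k _; rewrite funeposE /= EFinM; congr (_ * _)%E; rewrite -EFin_max.
rewrite (eq_bigr (fun k : 'I_N => ((w k)%:num * Num.max (- f (z k)) 0)%:E)) ?sumEFin; last first.
  by move=> k _; rewrite funenegE /= EFinM; congr (_ * _)%E; rewrite -EFin_max.
rewrite -EFinB /= -sumrB; apply: eq_bigr => k _; rewrite -mulrBr; congr (_ * _).
by rewrite /Num.max; case: ifPn; case: ifPn; lra.
Qed.

Lemma atomic_ae (P : borelC R -> Prop) : (forall k, (k < N)%N -> P (z k)) ->
  {ae nu, forall x, P x}.
Proof.
(* The null set is the complement of the set of atoms. *)
move=> Pz; exists (~` [set x | exists2 k, (k < N)%N & x = z k]); split.
- apply: measurableC.
  rewrite (_ : [set x | _] = \bigcup_(k in `I_N) [set z k]).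
    by apply: bigcup_measurable => k _; exact: measurable_borelC1.
  by apply/seteqP; split=> x [k kN xE]; exists k.
- rewrite atomicE big1 // => k _; rewrite diracE memNset ?mule0 //=.
  by apply; exists k.
- by move=> x /= nPx [k kN xz]; apply: nPx; rewrite xz; exact: Pz.
Qed.

End FiniteAtomic.

Section FiniteAtomicComplex.
Variables (R : realType) (z : nat -> borelC R) (w : nat -> {nonneg R}) (N : nat).
Hypothesis z_circle : forall k, (k < N)%N -> circle (z k).

Let nu : {measure set (borelC R) -> \bar R} :=
  msum (fun k => mscale (w k) (dirac (z k))) N.

Lemma cintegral_atomic (f : borelC R -> R[i]) : cmeasurable (@circle R) f ->
  cintegral nu f = \sum_(k < N) (w k)%:num%:C * f (z k).
Proof.
move=> [fr fi]; have mC := @measurable_circle R.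
rewrite /cintegral !Rintegral_atomic //.
have -> (s t : 'I_N -> R) : (\sum_k s k) +i* (\sum_k t k) = \sum_k (s k +i* t k).
  by elim/big_rec3: _ => [|k x y u _ <-].
apply: eq_bigr => k _; case: (f _) => x y /=.
by apply/eqP; rewrite eq_complex /= !mul0r subr0 addr0 !eqxx.
Qed.

Lemma square_integrable_atomic (f : borelC R -> R[i]) :
  cmeasurable (@circle R) f -> square_integrable nu f.
Proof.
move=> mf; have [fr fi] := mf; split => //.
rewrite ge0_integral_atomic //; first last.
- by apply/measurable_EFinP; exact: measurable_normC_sqr.
- by move=> x _; rewrite lee_fin sqr_ge0.
- exact: measurable_circle.
by under eq_bigr do rewrite -EFinM; rewrite sumEFin ltry.
Qed.

Lemma circle_probability_atomic :
  \sum_(k < N) (w k)%:num = 1 -> circle_probability nu.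
Proof.
move=> w1; split; rewrite atomicE.
  by under eq_bigr do rewrite diracT mule1; rewrite sumEFin w1.
rewrite big1 // => k _; rewrite diracE memNset ?mule0 //=.
by apply; exact: z_circle.
Qed.

End FiniteAtomicComplex.

Lemma eq_cmeasurable (R : realType) (D : set (borelC R)) (f g : borelC R -> R[i]) :
  {in D, f =1 g} -> cmeasurable D f -> cmeasurable D g.
Proof.
move=> fg [fr fi]; split.
  by apply: eq_measurable_fun fr => x Dx /=; rewrite fg.
by apply: eq_measurable_fun fi => x Dx /=; rewrite fg.
Qed.

(** * Enumeration of the zeros of the para-orthogonal function *)

Section ParaZeros.
Variables (R : realType) (alpha : nat -> R[i]) (phi : nat -> ratfun R).
Variables (n m : nat) (v : R[i]) (d : 'I_m -> R[i]).
Hypothesis zeroP : forall l, is_zero (para_orf alpha phi n v) l <-> exists i, l = d i.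

Lemma para_zeros_mem : para_zeros alpha phi n v =i [seq d i | i : 'I_m].
Proof.
(* Finiteness matters: [fset_set] returns the empty set on an infinite set. *)
have ZE : [set l | is_zero (para_orf alpha phi n v) l] = [set` [seq d i | i : 'I_m]].
  apply/seteqP; split=> l /=.
    by move=> /zeroP[i ->]; apply: map_f; rewrite mem_enum.
  by move=> /mapP[i _ ->]; apply/zeroP; exists i.
by move=> l; rewrite /para_zeros ZE; apply/idP/idP; rewrite in_fset_set //= inE.
Qed.

(** The zeros are listed in an unspecified order; both lists are free of repetition with the same
    members, so one permutes the other. *)
Lemma sum_para_zeros (S : nmodType) (F : R[i] -> S) : injective d ->
  let zs := para_zeros alpha phi n v in \sum_(k < size zs) F zs`_k = \sum_i F (d i).
Proof.
move=> d_inj zs; rewrite -(big_mkord xpredT (fun k => F zs`_k)) -(big_nth 0 xpredT F).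
rewrite (perm_big [seq d i | i : 'I_m]); last first.
  apply: uniq_perm; [exact: finmap.fset_uniq| |exact: para_zeros_mem].
  by rewrite map_inj_uniq // enum_uniq.
by rewrite big_map big_enum.
Qed.

End ParaZeros.

(** * Quadrature measure, eigenvectors and characteristic polynomial of the unitary matrix *)

Theorem theorem4p6 (R : realType) (mu : {measure set (borelC R) -> \bar R})
    (alpha : nat -> R[i]) (phi : nat -> ratfun R) (a : nat -> R[i])
    (n : nat) (v : R[i])
    (hmu : circle_probability mu) (hsupp : infinite_set (msupport mu))
    (halpha : disk_sequence alpha) (halpha0 : alpha 0%N = 0)
    (horf : is_ORF mu alpha phi a) (ha0 : a 0%N = 1)
    (hn : (1 <= n)%N) (hv : `|v| = 1) :
  let u := mobius (a n) v in
  let V : 'M[R[i]]_n :=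
    mobius_mx (principal (diag_seq alpha) n)
              (principal (hessenberg (set_entry a n u)) n) in
  let Q := para_orf alpha phi n v in
  [/\ matrix_of_mult (para_measure alpha phi n v)
        (fun k : 'I_n => reval (phi k)) V,
      (forall l : R[i], is_zero Q l <-> eigenvalue V l) /\
      (forall l : R[i], is_zero Q l -> forall x : 'cV[R[i]]_n,
        V *m x = l *: x <->
        exists c : R[i], x = c *: (\row_(k < n) reval (phi k) l)^t*) &
      exists q : {poly R[i]},
        Q = FracField.tofrac q / FracField.tofrac (pi_poly alpha n) /\
        exists2 c : R[i], c != 0 & q = c *: char_poly V].
Proof.
move=> u V Q.
have alpha_lt1 k : `|alpha k| < 1.
  by case: k => [|k]; [rewrite halpha0 normr0 ltr01|exact: halpha].
have a_lt1 := orf_disk horf.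
pose q := (orf_poly alpha a n).1 + v *: (orf_poly alpha a n).2.
pose p l : 'rV[R[i]]_n :=
  \row_(k < n) ((orf_poly alpha a k).1.[l] / (pi_poly alpha k).[l]).
have V_unitary : V \is unitarymx by exact: para_mx_unitary.
have p_span l (x : 'rV[R[i]]_n) : `|l| = 1 -> x *m V = l *: x -> exists c, x = c *: p l.
  by move=> l1; apply: para_left_eigen => //; rewrite l1.
have [d [d_inj d1 dP pV [orthP matP dualP]]] := unitary_simple_spectrum V_unitary p_span.
have [c c_neq0 qV] : exists2 c, c != 0 & q = c *: char_poly V.
  exact: (@para_poly_char_poly _ alpha a n v alpha_lt1 ha0 a_lt1 hn hv d).
have QE := para_orfE horf n v; rewrite -/q -/Q in QE.
have pi_neq0 := pi_poly_poly_neq0 alpha n.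
have d_le1 i : `|d i| <= 1 by rewrite d1.
have zeroP l : is_zero Q l <-> exists i, l = d i.
  split=> [/(is_zero_root pi_neq0 QE)|[i ->]].
    by rewrite qV rootZ // -eigenvalue_root_char => /dP.
  apply: (root_is_zero pi_neq0 QE); first exact: pi_poly_neq0.
  exact/(para_poly_root_eigen alpha_lt1 ha0 a_lt1 hn hv (d_le1 i))/pV.
have revalE k l : `|l| <= 1 ->
    reval (phi k) l = (orf_poly alpha a k).1.[l] / (pi_poly alpha k).[l].
  move=> l1; have [phiE _] := orf_polyE horf k.
  by rewrite (reval_quotient (pi_poly_poly_neq0 alpha k) phiE) // pi_poly_neq0.
have pE (k : 'I_n) l : `|l| <= 1 -> p l 0 k = reval (phi k) l.
  by move=> l1; rewrite revalE // mxE.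
split; last by exists q; split => //; exists c.
- pose zs := para_zeros alpha phi n v.
  pose w k : {nonneg R} := NngNum (para_weight_ge0 phi n zs`_k).
  have zs_d k : (k < size zs)%N -> exists i, zs`_k = d i.
    move=> /(mem_nth 0); rewrite (para_zeros_mem zeroP) => /mapP[i _ ->].
    by exists i.
  have z_circle k : (k < size zs)%N -> @circle R zs`_k.
    by move=> /zs_d[i ->]; rewrite /circle /= d1.
  (* On the circle pi_k has no zero, so [reval] agrees there with a quotient of polynomials. *)
  have reval_meas k : cmeasurable (@circle R) (reval (phi k)).
    apply: (@eq_cmeasurable _ _
      (fun z => (orf_poly alpha a k).1.[z] * (pi_poly alpha k).[z]^-1)).
      by move=> l; rewrite inE /circle /= => l1; rewrite revalE // l1.
    apply: cmeasurableM; first exact: cmeasurable_horner.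
    apply: cmeasurableV; [exact: measurable_circle| |exact: cmeasurable_horner].
    by move=> l; rewrite /circle /= => l1; rewrite pi_poly_neq0 // l1.
  have weightE i : (para_weight phi n (d i))%:C = christoffel p (d i).
    rewrite /para_weight /christoffel fmorphV rmorph_sum /=; congr (_^-1).
    by apply: eq_bigr => k _; rewrite rmorphXn /= normC_real pE.
  have sumE (F : R[i] -> R[i]) :
      \sum_(k < size zs) (w k)%:num%:C * F zs`_k =
      \sum_i christoffel p (d i) * F (d i).
    rewrite (sum_para_zeros zeroP (fun z => (para_weight phi n z)%:C * F z) d_inj).
    by apply: eq_bigr => i _; rewrite weightE.
  have innerE (f g : R[i] -> R[i]) :
      cmeasurable (@circle R) f -> cmeasurable (@circle R) g ->
      inner (para_measure alpha phi n v) f g =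
      \sum_i christoffel p (d i) * ((f (d i))^* * g (d i)).
    move=> mf mg; rewrite -(sumE (fun z => (f z)^* * g z)).
    apply: (cintegral_atomic (z := fun k => zs`_k) w) => //.
    by apply: cmeasurableM => //; exact: cmeasurable_conj.
  split.
  + suff sum_w : \sum_(k < size zs) (w k)%:num = 1.
      exact: (circle_probability_atomic z_circle sum_w).
    (* The total mass is the squared norm of phi_0 = 1. *)
    have := orthP (Ordinal hn) (Ordinal hn); rewrite eqxx => sum1.
    apply: complexI; rewrite rmorph_sum /= -[RHS]sum1.
    transitivity (\sum_(k < size zs) (w k)%:num%:C * 1).
      by apply: eq_bigr => k _; rewrite mulr1.
    rewrite (sumE (fun=> 1)); apply: eq_bigr => i _.
    have -> : p (d i) 0 (Ordinal hn) = 1.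
      by rewrite mxE /= /pi_poly big_geq // hornerC divr1.
    by rewrite rmorph1 !mulr1.
  + split.
    * move=> k; apply: (square_integrable_atomic (z := fun k => zs`_k) w) => //.
    * move=> j k; rewrite innerE // -orthP; apply: eq_bigr => i _.
      by rewrite !pE.
    * move=> g _.
      (* The coefficients are the Fourier coefficients of g for the discrete measure; [dualP] shows
         that the resulting sum interpolates g at every atom. *)
      exists (fun k => \sum_i christoffel p (d i) * ((reval (phi k) (d i))^* * g (d i))).
      apply: (atomic_ae (z := fun k => zs`_k) w) => m /zs_d[j ->] _.
      under eq_bigr do rewrite mulr_suml.
      rewrite exchange_big /=.
      transitivity (\sum_i (i == j)%:R * g (d i)).
        rewrite (bigD1 j) //= eqxx mul1r big1 ?addr0 // => i /negbTE ->.
        exact: mul0r.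
      apply: eq_bigr => i _; rewrite -dualP mulr_suml; apply: eq_bigr => k _.
      by rewrite !pE //; ring.
  + move=> j k; rewrite innerE // -?matP.
      by apply: eq_bigr => i _; rewrite !pE.
    exact: cmeasurableM (cmeasurable_id _) (reval_meas k).
- split=> [l|l]; first by rewrite zeroP dP.
  move=> /zeroP[i ->] x.
  have -> : \row_(k < n) reval (phi k) (d i) = p (d i).
    by apply/rowP => k; rewrite mxE pE.
  have key (y : 'rV[R[i]]_n) := unitary_left_right_eigen y V_unitary (d1 i).
  split=> [Vx|[b ->]]; last first.
    rewrite -scalemxAr; have /key -> := pV i.
    by rewrite !scalerA mulrC.
  (* The adjoint of x is a left eigenvector, hence a multiple of p(d_i); taking adjoints back
     conjugates the scalar. *)
  have /key : V *m (x^t*)^t* = d i *: (x^t*)^t* by rewrite trmxCK.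
  move/(p_span _ _ (d1 i)) => [b xE]; exists b^*.
  by rewrite -adjmxZ -xE trmxCK.
Qed.
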